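(* There exists an absolute constant $c>0$ such that the following holds. Let $d\ge1$, $\boldsymbol{L}=[L_1,\dots,L_d]$ with all $L_i>0$, $\boldsymbol{\sigma}=[\sigma_1,\dots,\sigma_d]$ with all $\sigma_i\ge0$, and $\Delta_f>0$. There is $T_0$ depending only on $d,\boldsymbol{L},\boldsymbol{\sigma},\Delta_f$ such that for every constant step size $\eta>0$ and every integer $T\ge T_0$ there exist a function $f:\mathbb{R}^d\to\mathbb{R}$, an initial point $\boldsymbol{x}_1$ and a stochastic gradient oracle for which, running SGD $\boldsymbol{x}_{t+1}=\boldsymbol{x}_t-\eta\boldsymbol{g}_t$ from $\boldsymbol{x}_1$: (i) $f$ is differentiable, $|f(\boldsymbol{y})-f(\boldsymbol{x})-\langle\nabla f(\boldsymbol{x}),\boldsymbol{y}-\boldsymbol{x}\rangle|\le\sum_{i=1}^d\frac{L_i}{2}|x_i-y_i|^2$ for all $\boldsymbol{x},\boldsymbol{y}\in\mathbb{R}^d$, and $f(\boldsymbol{x}_1)-\inf f\le\Delta_f$; (ii) the stochastic gradients satisfy $\mathbb{E}[\boldsymbol{g}_t\mid\mathcal{F}_{t-1}]=\nabla f(\boldsymbol{x}_t)$ and $\mathbb{E}[|g_{t,i}-\nabla_if(\boldsymbol{x}_t)|^2\mid\mathcal{F}_{t-1}]\le\sigma_i^2$ for all $t$ and all $i\in[d]$; (iii) $$\mathbb{E}\Big[\min_{1\le t\le T}\|\nabla f(\boldsymbol{x}_t)\|_1\Big]\ge c\bigg(\sqrt{\frac{d\,\|\boldsymbol{L}\|_\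infty\Delta_f}{T}}+\frac{d^{1/4}\Delta_f^{1/4}\big(\sum_{i=1}^d\sigma_i\sqrt{L_i}\big)^{1/2}}{T^{1/4}}\bigg).$$
   Context: A stochastic gradient oracle assigns to each point $\boldsymbol{x}$ a probability distribution on $\mathbb{R}^d$; conditionally on the past $\mathcal{F}_{t-1}$ (the $\sigma$-algebra generated by $\boldsymbol{x}_1,\dots,\boldsymbol{x}_t,\boldsymbol{g}_1,\dots,\boldsymbol{g}_{t-1}$), the stochastic gradient $\boldsymbol{g}_t=(g_{t,1},\dots,g_{t,d})$ is drawn from the distribution at $\boldsymbol{x}_t$. $\nabla_if$ is the $i$-th partial derivative, $[d]=\{1,\dots,d\}$, $\|\boldsymbol{L}\|_\infty=\max_iL_i$. *)

(* Defs.v *)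
From HB Require Import structures.
From mathcomp Require Import all_boot all_order all_algebra.
From mathcomp Require Import all_classical all_reals all_analysis.
Set Implicit Arguments.
Unset Strict Implicit.
Unset Printing Implicit Defensive.
Import Order.TTheory GRing.Theory Num.Theory.
Import numFieldNormedType.Exports.
Local Open Scope classical_set_scope.
Local Open Scope ring_scope.

(* R^d is the row-vector space 'rV[R]_d with its usual topology; borelRd is the
   same type carrying the Borel sigma-algebra. *)
Definition borelRd (R : realType) (d : nat) :=
  g_sigma_algebraType (@open 'rV[R]_d).

Definition partial (R : realType) (d : nat) (f : 'rV[R]_d -> R) (i : 'I_d)
    (x : 'rV[R]_d) : R :=
  'D_(delta_mx ord0 i) f x.

Definition grad_l1norm (R : realType) (d : nat) (f : 'rV[R]_d -> R)
    (x : 'rV[R]_d) : R :=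
  \sum_(i < d) `|partial f i x|.

Definition coordinate_smooth (R : realType) (d : nat) (L : 'I_d -> R)
    (f : 'rV[R]_d -> R) : Prop :=
  (forall x, differentiable f x) /\
  (forall x y : 'rV[R]_d,
     `|f y - f x - \sum_(i < d) partial f i x * (y ord0 i - x ord0 i)|
       <= \sum_(i < d) L i / 2 * `|x ord0 i - y ord0 i| ^+ 2).

(* The infimum is taken in the extended reals, so that the bound fails for a
   function that is not bounded below. *)
Definition initial_gap_le (R : realType) (d : nat) (f : 'rV[R]_d -> R)
    (x1 : 'rV[R]_d) (Delta : R) : Prop :=
  ((f x1)%:E - ereal_inf (range (fun x => (f x)%:E)) <= Delta%:E)%E.

(* Y is a version of the conditional expectation of X given the
   sub-sigma-algebra F. *)
Definition is_cond_exp (R : realType) (disp : measure_display)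
    (Omega : measurableType disp) (P : probability Omega R)
    (F : set (set Omega)) (X Y : Omega -> R) : Prop :=
  [/\ P.-integrable setT (EFin \o X),
      P.-integrable setT (EFin \o Y),
      (forall B : set R, measurable B -> F (Y @^-1` B)) &
      (forall A : set Omega, F A ->
         (\int[P]_(w in A) (Y w)%:E = \int[P]_(w in A) (X w)%:E)%E)].

Definition oracle (R : realType) (d : nat) :=
  R.-pker (borelRd R d) ~> (borelRd R d).

(* The sigma-algebra F_(t-1) generated by x_1, ..., x_t, g_1, ..., g_(t-1);
   processes are indexed from 1 and their value at index 0 is irrelevant. *)
Definition history (R : realType) (d : nat) (Omega : Type)
    (x g : nat -> Omega -> 'rV[R]_d) (t : nat) : set (set Omega) :=
  <<s (\bigcup_(s in [set s | 1 <= s <= t]%N)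
         preimage_set_system setT (x s : Omega -> borelRd R d) measurable) `|`
      (\bigcup_(s in [set s | 1 <= s < t]%N)
         preimage_set_system setT (g s : Omega -> borelRd R d) measurable) >>.

(* The last field says that K (x_t) is the conditional law of g_t given
   F_(t-1). *)
Record sgd_run (R : realType) (d : nat) (eta : R) (x1 : 'rV[R]_d)
    (K : oracle R d) (disp : measure_display) (Omega : measurableType disp)
    (P : probability Omega R) (x g : nat -> Omega -> 'rV[R]_d) : Prop := {
  sgd_measurable_x : forall t, (1 <= t)%N ->
    measurable_fun setT (x t : Omega -> borelRd R d) ;
  sgd_measurable_g : forall t, (1 <= t)%N ->
    measurable_fun setT (g t : Omega -> borelRd R d) ;
  sgd_init : forall w, x 1%N w = x1 ;
  sgd_step : forall t, (1 <= t)%N ->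
    forall w, x t.+1 w = x t w - eta *: g t w ;
  sgd_law : forall t, (1 <= t)%N ->
    forall A : set (borelRd R d), measurable A ->
      is_cond_exp P (history x g t)
        (\1_(g t @^-1` A)) (fun w => fine (K (x t w) A)) }.

Definition unbiased (R : realType) (d : nat) (f : 'rV[R]_d -> R)
    (disp : measure_display) (Omega : measurableType disp)
    (P : probability Omega R) (x g : nat -> Omega -> 'rV[R]_d) : Prop :=
  forall (t : nat) (i : 'I_d), (1 <= t)%N ->
    is_cond_exp P (history x g t)
      (fun w => g t w ord0 i) (fun w => partial f i (x t w)).

Definition coordinate_variance_le (R : realType) (d : nat) (sigma : 'I_d -> R)
    (f : 'rV[R]_d -> R) (disp : measure_display) (Omega : measurableType disp)
    (P : probability Omega R) (x g : nat -> Omega -> 'rV[R]_d) : Prop :=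
  forall (t : nat) (i : 'I_d), (1 <= t)%N ->
    exists V : Omega -> R,
      is_cond_exp P (history x g t)
        (fun w => `|g t w ord0 i - partial f i (x t w)| ^+ 2) V /\
      {ae P, forall w, V w <= sigma i ^+ 2}.

(* min_(1 <= t <= T) v_t, for T >= 1 *)
Definition min_upto (R : realType) (T : nat) (v : nat -> R) : R :=
  \big[Num.min/v 1%N]_(1 <= t < T.+1) v t.

(* Main.v *)
(* For a step size above twice the inverse of the largest curvature, a quadratic in
   one coordinate makes noiseless SGD expand, so the gradient never gets small.  For
   smaller step sizes two constructions compete.  A Huber-like plateau of slope g in
   every coordinate keeps the gradient equal to g for T noiseless steps at a cost
   of about d eta g^2 T in the initial gap, which allows d g of order
   sqrt (d Delta / (eta T)).  A separable quadratic whose noise either does nothing or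
   flips the sign of one coordinate (coordinate i with probability eta L_i / 2) keeps
   every |x_i| constant; variance sigma_i^2 permits
   L_i |x_i| = sigma_i sqrt (eta L_i / 2), whose sum over i grows like sqrt eta.  The
   geometric mean of the two bounds is independent of eta and equals the noise-dependent
   rate, so the better of the two always reaches it; for large T that rate
   dominates the noiseless one as soon as some sigma_i is positive, and every
   bound that is independent of T is eventually larger than the target. *)
Require Import Defs.
From HB Require Import structures.
From mathcomp Require Import all_boot all_order all_algebra.
From mathcomp Require Import all_classical all_reals all_analysis.
From mathcomp Require Import measurable_realfun ring lra.
Set Implicit Arguments.
Unset Strict Implicit.
Unset Printing Implicit Defensive.
Import Order.TTheory GRing.Theory Num.Theory.
Import numFieldNormedType.Exports.
Local Open Scope classical_set_scope.
Local Open Scope ring_scope.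

(** * Borel measurability and finite mixture oracles *)

Section borel_vectors.
Context {R : realType} {d : nat}.
Local Notation B := (borelRd R d).

Lemma borel_continuous (h : 'rV[R]_d -> R) :
  continuous h -> measurable_fun [set: B] (h : B -> R).
Proof.
move=> /continuousP ch; apply: (measurability _ (RGenOpens.measurableE R)).
move=> _ [_ [a [b ->]] <-]; rewrite setTI; apply: sub_sigma_algebra.
by apply: ch; exact: interval_open.
Qed.

Lemma borel_coord (i : 'I_d) :
  measurable_fun [set: B] ((fun v => v ord0 i) : B -> R).
Proof. by apply: borel_continuous; exact: coord_continuous. Qed.

Lemma borel_endo_continuous (h : 'rV[R]_d -> 'rV[R]_d) :
  continuous h -> measurable_fun [set: B] (h : B -> B).
Proof.
move=> /continuousP ch.
apply: (@measurability _ _ B B setT h (@open 'rV[R]_d)) => //.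
by move=> _ [U oU <-]; rewrite setTI; apply: sub_sigma_algebra; exact: ch.
Qed.

End borel_vectors.

Section mixture.
Context {R : realType} {d : nat}.
Local Notation B := (borelRd R d).
Variables (n : nat) (w : nat -> {nonneg R}) (G : nat -> B -> B).

(** Oracles that choose among finitely many deterministic maps suffice, and they turn expectations
    into finite sums. The kernel is a weighted sum of Dirac masses; indices are natural numbers
    because [msum] takes a sequence of measures. *)
Lemma mixture_oracle : (forall j, measurable_fun setT (G j)) ->
  \sum_(j < n) (w j)%:num = 1 ->
  exists K : oracle R d, forall x A, measurable A ->
    K x A = (\sum_(j < n) (w j)%:num * \1_A (G j x))%:E.
Proof.
move=> mG w1.
pose k (x : B) : {measure set B -> \bar R} :=
  msum (fun j => mscale (w j) \d_(G j x)) n.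
have kE x A : k x A = (\sum_(j < n) (w j)%:num * \1_A (G j x))%:E.
  by rewrite -sumEFin; apply: eq_bigr => j _; rewrite /= /mscale /= diracE EFinM indicE.
have mk U : measurable U -> measurable_fun [set: B] (k ^~ U).
  move=> mU; under eq_fun do rewrite kE.
  apply/measurable_EFinP; apply: measurable_sum => j.
  by apply: measurable_funM => //; apply: measurableT_comp.
have k1 x : k x setT = 1%E.
  by rewrite kE; under eq_bigr do rewrite indicT mulr1; rewrite w1.
pose M1 := isKernel.Build _ _ B B R k mk.
pose K0 : R.-ker B ~> B := HB.pack k M1.
pose M2 := Kernel_isProbability.Build _ _ B B R K0 k1.
pose K : oracle R d := HB.pack (K0 : B -> {measure set B -> \bar R}) M1 M2.
by exists K => x A mA; rewrite -kE.
Qed.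

End mixture.

(** * Runs driven by a finite mixture oracle *)

Section run_of_mixture.
Context {R : realType} {d : nat}.
Local Notation B := (borelRd R d).
Context {n : nat} {w : nat -> {nonneg R}} {G : nat -> B -> B}.
Hypothesis mG : forall j, measurable_fun setT (G j).
Context {K : oracle R d}.
Hypothesis KE : forall x A, measurable A ->
  K x A = (\sum_(j < n) (w j)%:num * \1_A (G j x))%:E.
Context {eta : R} {x1 : 'rV[R]_d} {disp : measure_display}
  {Omega : measurableType disp} {P : probability Omega R}
  {x g : nat -> Omega -> 'rV[R]_d}.
Hypothesis run : sgd_run eta x1 K P x g.

Let mx t : (1 <= t)%N -> measurable_fun setT (x t : Omega -> B) :=
  @sgd_measurable_x _ _ _ _ _ _ _ _ _ _ run t.
Let mgr t : (1 <= t)%N -> measurable_fun setT (g t : Omega -> B) :=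
  @sgd_measurable_g _ _ _ _ _ _ _ _ _ _ run t.

Lemma history_measurable t : history x g t `<=` measurable.
Proof.
apply: smallest_sub; first exact: sigma_algebra_measurable.
move=> _ [[s /andP[s1 _] [A mA <-]]|[s /andP[s1 _] [A mA <-]]].
  exact: mx.
exact: mgr.
Qed.

Lemma history_iterate t (A : set B) : (1 <= t)%N -> measurable A ->
  history x g t (x t @^-1` A).
Proof.
move=> t1 mA; apply: sub_sigma_algebra; left; exists t; first by rewrite /= t1 leqnn.
by exists A => //; rewrite setTI.
Qed.

Let sigma_algebra_history t : sigma_algebra setT (history x g t) :=
  smallest_sigma_algebra setT _.

Lemma historyT t : history x g t setT.
Proof. by have [h0 hC _] := sigma_algebra_history t; rewrite -(setD0 setT); exact: hC. Qed.

Lemma historyI t F F' : history x g t F -> history x g t F' ->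
  history x g t (F `&` F').
Proof.
by have /sigma_algebraP[] // := sigma_algebra_history t => _ _ _; apply.
Qed.

Local Open Scope ereal_scope.

(** Testing [sgd_law] on the history event [F] gives the left side; the formula for [K] splits the
    other integral letter by letter. *)
Lemma gradient_law t F (A : set B) : (1 <= t)%N -> history x g t F ->
  measurable A -> P (F `&` g t @^-1` A) =
  \sum_(j < n) (w j)%:num%:E * P (F `&` (G j \o x t) @^-1` A).
Proof.
move=> t1 hF mA.
have mF := history_measurable hF.
have mgA : measurable (g t @^-1` A) by rewrite -[X in measurable X]setTI; exact: mgr.
have mGx j : measurable ((G j \o x t) @^-1` A).
  by rewrite -[X in measurable X]setTI; apply: (measurableT_comp (mG j) (mx t1)).
have [_ _ _ /(_ F hF)] := @sgd_law _ _ _ _ _ _ _ _ _ _ run t t1 A mA.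
rewrite integral_indic// setIC => <-.
under eq_integral => o _.
  rewrite KE//= -sumEFin.
  under eq_bigr do rewrite EFinM.
  over.
rewrite ge0_integral_sum//; last first.
- move=> j; apply: measurable_funeM; apply/measurable_EFinP.
  apply: measurable_funTS.
  by apply: (measurableT_comp (measurable_indic mA)); apply: (measurableT_comp (mG j) (mx t1)).
apply: eq_bigr => j _.
rewrite ge0_integralZl_EFin//; last first.
- apply/measurable_EFinP; apply: measurable_funTS.
  by apply: (measurableT_comp (measurable_indic mA)); apply: (measurableT_comp (mG j) (mx t1)).
by congr (_ * _); rewrite setIC -integral_indic.
Qed.

Let mxg t : (1 <= t)%N ->
  measurable_fun setT ((fun o => (x t o, g t o)) : Omega -> B * B).
Proof. by move=> t1; apply: measurable_fun_pair; [exact: mx|exact: mgr]. Qed.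

Let mxG t j : (1 <= t)%N ->
  measurable_fun setT ((fun o => (x t o, G j (x t o))) : Omega -> B * B).
Proof.
move=> t1; apply: measurable_fun_pair; first exact: mx.
exact: (measurableT_comp (mG j) (mx t1)).
Qed.

(* Both sides are integrals against measures on pairs, which agree on rectangles because
   [x t] is measurable for the history. *)
Lemma integral_joint_law t F (f : B * B -> \bar R) : (1 <= t)%N ->
  history x g t F -> measurable_fun setT f -> (forall z, 0 <= f z) ->
  \int[P]_(o in F) f (x t o, g t o) =
  \sum_(j < n) (w j)%:num%:E * \int[P]_(o in F) f (x t o, G j (x t o)).
Proof.
move=> t1 hF mf f0.
have mF := history_measurable hF.
(* Restricting [P] to [F] turns integrals over [F] into integrals over the whole space, to which the
   change of variables for pushforwards applies. *)
pose PF : {measure set Omega -> \bar R} := mrestr P mF.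
have PFE h : measurable_fun setT h -> (forall o, 0 <= h o) ->
    \int[PF]_o h o = \int[P]_(o in F) h o.
  move=> mh h0; rewrite [RHS](eq_measure_integral PF); last first.
    by move=> A mA AF; rewrite /PF /= /mrestr setIidl.
  rewrite [RHS]integral_mkcond; apply: ae_eq_integral => //.
    by apply/(measurable_restrict _ mF) => //; rewrite setTI; exact: measurable_funTS.
  exists (~` F); split; first exact: measurableC.
    by rewrite /PF /= /mrestr setICl measure0.
  by apply: subsetC => o Fo _; rewrite /= patchE mem_set.
pose m1_ : {measure set (B * B) -> \bar R} :=
  pushforward PF ((fun o => (x t o, g t o)) : Omega -> B * B).
pose m1 := m1_ (mxg t1).
pose m2_ j : {measure set (B * B) -> \bar R} :=
  pushforward PF ((fun o => (x t o, G j (x t o))) : Omega -> B * B).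
pose m2 := m2_ (fun j => @mxG t j t1).
pose m3 : {measure set (B * B) -> \bar R} := msum (fun j => mscale (w j) (m2 j)) n.
have m13 E : measurable E -> m1 E = m3 E.
  apply: (measure_unique [set A `*` A' | A in measurable & A' in measurable]
    (fun=> setT)).
  - exact: measurable_prod_measurableType.
  - move=> _ _ [A1 mA1 [A1' mA1' <-]] [A2 mA2 [A2' mA2' <-]].
    rewrite -setXI; exists (A1 `&` A2); first exact: measurableI.
    by exists (A1' `&` A2') => //; exact: measurableI.
  - by move=> _; exists setT => //; exists setT => //; rewrite setXTT.
  - by rewrite bigcup_const.
  - move=> _ [A mA [A' mA' <-]].
    have hFA : history x g t (F `&` x t @^-1` A).
      by apply: historyI => //; exact: history_iterate.
    rewrite /m1 /m1_ /= /pushforward /PF /= /mrestr.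
    have -> : (fun o => (x t o, g t o)) @^-1` (A `*` A') `&` F =
        (F `&` x t @^-1` A) `&` g t @^-1` A'.
      by apply/seteqP; split => o /= [[? ?] ?]; do !split.
    rewrite (gradient_law t1 hFA mA'); apply: eq_bigr => j _.
    rewrite /mscale /= /pushforward /mrestr; congr (_ * P _).
    by apply/seteqP; split => o /= [[? ?] ?]; do !split.
  - move=> _; rewrite /m1 /m1_ /= /pushforward /PF /= /mrestr preimage_setT setTI.
    by rewrite (le_lt_trans (probability_le1 _ _))// ltry.
have <- : \int[m1]_z f z = \int[P]_(o in F) f (x t o, g t o).
  rewrite (ge0_integral_pushforward (mxg t1))//.
  rewrite preimage_setT PFE//; last by move=> o; exact: f0.
  by apply: (measurableT_comp mf); exact: mxg.
transitivity (\int[m3]_z f z).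
  by apply: eq_measure_integral => E mE _; exact: m13.
rewrite ge0_integral_measure_sum//; apply: eq_bigr => j _.
rewrite ge0_integral_mscale//; congr (_ * _).
rewrite (ge0_integral_pushforward (@mxG t j t1))//.
rewrite preimage_setT PFE//; last by move=> o; exact: f0.
by apply: (measurableT_comp mf); exact: mxG.
Qed.

End run_of_mixture.

Lemma ae_bounded_integrable {disp : measure_display} {T : measurableType disp}
    {R : realType} (P : probability T R) (f : T -> R) (b : R) :
  measurable_fun setT f -> {ae P, forall o, `|f o| <= b} ->
  P.-integrable setT (EFin \o f).
Proof.
move=> mf fb; apply/integrableP; split; first exact/measurable_EFinP.
have mnf : measurable_fun setT (fun o => `|f o|) by exact: measurableT_comp.
(* Truncation at [|b|] gives a function bounded everywhere that agrees almost everywhere with the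
   absolute value of [f]. *)
have mmin : measurable_fun setT (fun o => Num.min `|f o| `|b|).
  exact: measurable_minr.
rewrite (@ge0_ae_eq_integral _ _ _ P setT _ (fun o => (Num.min `|f o| `|b|)%:E))//.
- apply: (@le_lt_trans _ _ (\int[P]_o (cst `|b|%:E o))%E).
    apply: ge0_le_integral => //.

    + exact/measurable_EFinP.
    + by move=> o _; rewrite lee_fin ge_min lexx orbT.
  by rewrite integral_cst//= probability_setT mule1 ltry.
- exact/measurable_EFinP.
- exact/measurable_EFinP.
- apply: filterS fb => o fob _ /=; congr EFin; apply/esym/min_idPl.
  by rewrite (le_trans fob)// ler_norm.
Qed.

Lemma measurable_forall_fin {disp : measure_display} {T : measurableType disp}
    (I : finType) (F : I -> set T) :
  (forall i, measurable (F i)) -> measurable [set z | forall i, F i z].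
Proof.
move=> mF; rewrite (_ : [set z | _] = \bigcap_i F i).
  by apply: fin_bigcap_measurable => // i _; exact: mF.
by apply/seteqP; split => [z Fz i _|z Fz i]; [exact: Fz|exact: Fz].
Qed.

(** * Almost sure invariants and conditional expectations along a run *)

Section invariant_of_mixture_run.
Context {R : realType} {d : nat}.
Local Notation B := (borelRd R d).
Context {n : nat} {w : nat -> {nonneg R}} {G : nat -> B -> B}.
Hypothesis mG : forall j, measurable_fun setT (G j).
Context {K : oracle R d}.
Hypothesis KE : forall x A, measurable A ->
  K x A = (\sum_(j < n) (w j)%:num * \1_A (G j x))%:E.
Context {eta : R} {x1 : 'rV[R]_d} {disp : measure_display}
  {Omega : measurableType disp} {P : probability Omega R}
  {x g : nat -> Omega -> 'rV[R]_d}.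
Hypothesis run : sgd_run eta x1 K P x g.
Context {Q : nat -> 'I_d -> set R}.
Hypothesis mQ : forall t i, measurable (Q t i).
Hypothesis Q1 : forall i, Q 1 i (x1 ord0 i).
Hypothesis QS : forall t (z : 'rV[R]_d), (1 <= t)%N -> (forall i, Q t i (z ord0 i)) ->
  forall (j : 'I_n) i, Q t.+1 i (z ord0 i - eta * (G j z : 'rV[R]_d) ord0 i).

(** By induction on time: the event that the invariant holds at one time and fails at the next has
    probability given by the joint law, and every term of that sum vanishes by [QS]. Only an almost
    sure statement is possible, since [sgd_run] prescribes the law of the gradients and not their
    values. *)
Lemma ae_invariant t : (1 <= t)%N ->
  {ae P, forall o, forall i, Q t i (x t o ord0 i)}.
Proof.
elim: t => // -[_ _|t IH _].
  by apply: aeW => o i; rewrite (sgd_init run).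
have {IH}IH := IH isT.
pose E : set (B * B) := [set z | (forall i, Q t.+1 i ((z.1 : 'rV[R]_d) ord0 i)) /\
  ~ (forall i, Q t.+2 i ((z.1 : 'rV[R]_d) ord0 i - eta * (z.2 : 'rV[R]_d) ord0 i))].
have mc1 i : measurable_fun setT (fun z : B * B => (z.1 : 'rV[R]_d) ord0 i).
  exact: (measurableT_comp (borel_coord i) measurable_fst).
have mc2 i : measurable_fun setT (fun z : B * B => (z.2 : 'rV[R]_d) ord0 i).
  exact: (measurableT_comp (borel_coord i) measurable_snd).
have mE : measurable E.
  apply: measurableI.
    apply: measurable_forall_fin => i.
    by rewrite -[X in measurable X]setTI; exact: mc1.
  apply: measurableC; apply: measurable_forall_fin => i.
  rewrite -[X in measurable X]setTI.
  by apply: (measurable_funB (mc1 i) (measurable_funM (measurable_cst eta) (mc2 i))).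
have PE : (\int[P]_(o in setT) (\1_E (x t.+1 o, g t.+1 o))%:E = 0)%E.
  rewrite (integral_joint_law mG KE run (f := EFin \o \1_E))//.
  - rewrite big1// => j _; rewrite integral0_eq ?mule0// => o _ /=.
    rewrite indicE memNset// => -[/= Qx]; apply => i.
    exact: QS.
  - exact: historyT.
  - exact/measurable_EFinP.
  - by move=> z; rewrite /= lee_fin.
have {PE}PE : {ae P, forall o, ~ E (x t.+1 o, g t.+1 o)}.
  have mxg : measurable_fun setT ((fun o => (x t.+1 o, g t.+1 o)) : Omega -> B * B).
    by apply: measurable_fun_pair; [exact: (sgd_measurable_x run)|
      exact: (sgd_measurable_g run)].
  have mpE : measurable ((fun o => (x t.+1 o, g t.+1 o)) @^-1` E).
    by rewrite -[X in measurable X]setTI; exact: mxg.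
  exists ((fun o => (x t.+1 o, g t.+1 o)) @^-1` E); split => //.
    by rewrite -[X in P X]setIT -integral_indic.
  by move=> o /= /contrapT.
apply: filterS2 IH PE => o Qx nE.
apply: contrapT => nQ; apply: nE; split => //= Qx2; apply: nQ => i.
by rewrite (sgd_step run)// !mxE.
Qed.

Lemma ae_invariant_integrable t (phi : B * B -> R) b : (1 <= t)%N ->
  measurable_fun setT phi ->
  (forall z : 'rV[R]_d, (forall i, Q t i (z ord0 i)) -> forall j : 'I_n, `|phi (z, G j z)| <= b) ->
  forall j : 'I_n, P.-integrable setT (fun o => (phi (x t o, G j (x t o)))%:E).
Proof.
move=> t1 mphi phib j; apply:
  (@ae_bounded_integrable _ _ _ P (fun o => phi (x t o, G j (x t o))) b).
  apply: (measurableT_comp mphi); apply: measurable_fun_pair.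
    exact: (sgd_measurable_x run).
  exact: (measurableT_comp (mG j) (sgd_measurable_x run t1)).
by apply: filterS (ae_invariant t1) => o /phib /(_ j).
Qed.

(** Given the history, [x t] is known and [g t] is distributed as [G j (x t)] with weight [w j], so
    conditioning averages over [j]. Integrability only needs a bound on the invariant set, where the
    iterates stay almost surely. *)
Lemma cond_exp_mixture t (phi : B * B -> R) b : (1 <= t)%N ->
  measurable_fun setT phi ->
  (forall z : 'rV[R]_d, (forall i, Q t i (z ord0 i)) -> forall j : 'I_n, `|phi (z, G j z)| <= b) ->
  is_cond_exp P (history x g t) (fun o => phi (x t o, g t o))
    (fun o => \sum_(j < n) (w j)%:num * phi (x t o, G j (x t o))).
Proof.
move=> t1 mphi phib.
have mxt : measurable_fun setT (x t : Omega -> B) := sgd_measurable_x run t1.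
have iY := ae_invariant_integrable t1 mphi phib.
have iX : P.-integrable setT (fun o => (phi (x t o, g t o))%:E).
  apply/integrableP; split.
    apply/measurable_EFinP; apply: (measurableT_comp mphi).
    by apply: measurable_fun_pair => //; exact: (sgd_measurable_g run).
  rewrite (integral_joint_law mG KE run (f := fun z => `|(phi z)%:E|%E) t1)//.
  - apply: lte_sum_pinfty => j _.
    rewrite lte_mul_pinfty//.
    by have /integrableP[] := iY j.
  - exact: historyT.
  - by apply: measurableT_comp => //; exact/measurable_EFinP.
pose psi j (z : B) := phi (z, G j z).
have mpsi j : measurable_fun setT (psi j).
  apply: (measurableT_comp mphi).
  by apply: measurable_fun_pair => //; exact: mG.
have YE : EFin \o (fun o => \sum_(j < n) (w j)%:num * phi (x t o, G j (x t o))) =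
    fun o => (\sum_(j < n) (w j)%:num%:E * (psi j (x t o))%:E)%E.
  by apply/funext => o /=; rewrite -sumEFin; apply: eq_bigr => j _; rewrite EFinM.
have iwY (j : 'I_n) : P.-integrable setT (fun o => (w j)%:num%:E * (psi j (x t o))%:E)%E.
  by apply: integrableZl => //; exact: iY.
split => //.
- by rewrite YE; apply: integrable_sum.
- move=> D mD; apply: (history_iterate
    (A := (fun z => \sum_(j < n) (w j)%:num * psi j z) @^-1` D)) => //.
  rewrite -[X in measurable X]setTI.
  have : measurable_fun [set: B] (fun z => \sum_(j < n) (w j)%:num * psi j z).
    by apply: measurable_sum => j; exact: measurable_funM.
  exact.
move=> F hF.
have mF := history_measurable run hF.
(* The joint law formula is for nonnegative functions, so the positive and negative parts of [phi]
   are treated separately; finiteness of the negative parts allows the two sums to be recombined. *)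
rewrite [RHS]integralE.
have mphip : measurable_fun setT (EFin \o phi)^\+%E.
  by apply: measurable_funepos; exact/measurable_EFinP.
have mphin : measurable_fun setT (EFin \o phi)^\-%E.
  by apply: measurable_funeneg; exact/measurable_EFinP.
have iYF (j : 'I_n) : P.-integrable F (fun o => (psi j (x t o))%:E).
  by apply: (integrableS measurableT mF (@subsetT _ _)); exact: iY.
have posE (h : Omega -> B * B) : (\int[P]_(o in F) (EFin \o phi)^\+ (h o) =
    \int[P]_(o in F) (fun o => (phi (h o))%:E)^\+ o)%E.
  by apply: eq_integral => o _; rewrite !funeposE.
have negE (h : Omega -> B * B) : (\int[P]_(o in F) (EFin \o phi)^\- (h o) =
    \int[P]_(o in F) (fun o => (phi (h o))%:E)^\- o)%E.
  by apply: eq_integral => o _; rewrite !funenegE.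
have := integral_joint_law mG KE run t1 hF mphip (funepos_ge0 _).
have := integral_joint_law mG KE run t1 hF mphin (funeneg_ge0 _).
rewrite posE negE => -> ->.
rewrite -fin_num_sumeN; last first.
  move=> j _; rewrite fin_numM// negE.
  exact: (integrable_neg_fin_num mF (iYF j)).
rewrite -big_split/=.
rewrite (eq_integral (fun o => \sum_(j < n) (w j)%:num%:E * (psi j (x t o))%:E)%E);
  last by move=> o _; rewrite -(congr1 (@^~ o) YE).
rewrite integral_sum//; last first.
  by move=> j; apply: (integrableS measurableT mF (@subsetT _ _)); exact: iwY.
apply: eq_bigr => j _; rewrite integralZl//.
rewrite posE negE integralE muleBr//.
by rewrite fin_num_adde_defr// (integrable_pos_fin_num mF (iYF j)).
Qed.
End invariant_of_mixture_run.

(** * Existence of a run *)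

Section bernoulli_shift.
Context {R : realType} {disp : measure_display} {Omega : measurableType disp}
  {P : probability Omega R} {n : nat} {w : nat -> {nonneg R}}
  {D : Omega -> nat} {S : Omega -> Omega}.
Hypothesis D_lt : forall o, (D o < n)%N.
Hypothesis mD : forall j, measurable [set o | D o = j].
Hypothesis mS : measurable_fun setT S.
Hypothesis D_S : forall j A, (j < n)%N -> measurable A ->
  P ([set o | D o = j] `&` S @^-1` A) = ((w j)%:num%:E * P A)%E.

(* D reads the first letter of an i.i.d. sequence encoded by o, and S drops it. *)
Fixpoint word k o := if k is k'.+1 then D o :: word k' (S o) else [::].

Lemma wordSr k o : word k.+1 o = rcons (word k o) (D (iter k S o)).
Proof.
elim: k o => // k IH o.
by rewrite [LHS]/= -/(word k.+1 (S o)) IH -iterSr.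
Qed.

Lemma word_prefix i k o o' : (i <= k)%N -> word k o = word k o' ->
  word i o = word i o'.
Proof.
elim: k => [|k IH]; first by rewrite leqn0 => /eqP ->.
rewrite leq_eqVlt => /predU1P[-> //|ik].
by rewrite !wordSr => /rcons_inj[/IH-/(_ ik)].
Qed.

(** These are the unions of cylinders of length [k]. The pointwise form makes closure under the
    sigma-algebra operations immediate and postpones measurability. *)
Definition word_determined k (F : set Omega) :=
  forall o o', word k o = word k o' -> F o -> F o'.

Lemma word_determinedW i k F : (i <= k)%N ->
  word_determined i F -> word_determined k F.
Proof. by move=> ik iF o o' /(word_prefix ik)/iF. Qed.

Lemma word_determinedI k F F' : word_determined k F -> word_determined k F' ->
  word_determined k (F `&` F').
Proof. by move=> hF hF' o o' oo' [/(hF _ _ oo') ? /(hF' _ _ oo') ?]. Qed.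

Lemma sigma_algebra_word_determined k :
  sigma_algebra setT [set F | word_determined k F].
Proof.
split=> /=.
- by move=> o o' _ [].
- by move=> F hF o o' oo' [_ nF]; split => // /(hF _ _ (esym oo')).
- by move=> F hF o o' oo' [i _ Fi]; exists i => //; exact: hF Fi.
Qed.

(** The image under [S] of the part of [F] with first letter [j], saturated by words of length [k].
    Saturation makes it word-determined, so that inductions on [k] apply even though the image
    itself need not be measurable. *)
Let branch k (F : set Omega) j : set Omega :=
  [set o' | exists o, [/\ F o, D o = j & word k (S o) = word k o']].

Let branch_determined k F j : word_determined k (branch k F j).
Proof. by move=> o o' e [p [Fp Dp pE]]; exists p; rewrite -e. Qed.

Let branchE k F j : word_determined k.+1 F ->
  F `&` [set o | D o = j] = [set o | D o = j] `&` S @^-1` branch k F j.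
Proof.
move=> hF; apply/seteqP; split => [ o [Fo Do]|o [Do [p [Fp Dp pE]]]].
  by split => //=; exists o.
by split => //; apply: hF Fp; rewrite /= Dp pE Do.
Qed.

Let cover_letters (F : set Omega) :
  F = \big[setU/set0]_(j < n) (F `&` [set o | D o = j]).
Proof.
rewrite -(bigcup_mkord n (fun j => F `&` [set o | D o = j])).
apply/seteqP; split => [ o Fo|o [j _ []] //].
by exists (D o) => //=.
Qed.

(** At length 0 the set is empty or full; otherwise it is a finite union over the first letter of
    preimages under [S] of sets determined by a shorter word. *)
Lemma measurable_word_determined k F : word_determined k F -> measurable F.
Proof.
elim: k F => [|k IH] F hF.
  have [->|/set0P[ o Fo]] := eqVneq F set0; first exact: measurable0.
  rewrite (_ : F = setT); first exact: measurableT.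
  by apply/seteqP; split => // o' _; exact: hF Fo.
rewrite (cover_letters F); apply: bigsetU_measurable => j _.
rewrite (branchE _ hF); apply: measurableI => //.
rewrite -[X in measurable X]setTI; apply: mS => //.
by apply: IH; exact: branch_determined.
Qed.

Lemma measurable_iter_shift k : measurable_fun setT (iter k S).
Proof.
elim: k => [|k IH]; first exact: measurable_id.
exact: (measurableT_comp mS IH).
Qed.

Let measurable_preim_shift k A : measurable A -> measurable (iter k S @^-1` A).
Proof. by move=> mA; rewrite -[X in measurable X]setTI; exact: measurable_iter_shift. Qed.

Lemma sum_letters F : measurable F ->
  P F = (\sum_(j < n) P (F `&` [set o | D o = j]))%E.
Proof.
move=> mF; rewrite {1}(cover_letters F).
rewrite (@measure_bigsetU _ _ _ P (fun j => F `&` [set o | D o = j]))//.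
  by move=> j; exact: measurableI.
apply/trivIsetP => i j _ _ /eqP ij; apply/seteqP; split => // u [[_ Di] [_ Dj]].
by case: ij; rewrite -Di -Dj.
Qed.

(** The first [k] letters are independent of the sequence that remains after them: split on the
    first letter, factor its weight out by [D_S], and use the induction hypothesis on the branch. *)
Lemma word_independent k F A : word_determined k F -> measurable A ->
  P (F `&` iter k S @^-1` A) = (P F * P A)%E.
Proof.
elim: k F => [|k IH] F hF mA.
  have [->|/set0P[ o Fo]] := eqVneq F set0; first by rewrite set0I measure0 mul0e.
  rewrite (_ : F = setT) ?setTI ?probability_setT ?mul1e//.
  by apply/seteqP; split => // o' _; exact: hF Fo.
have mF := measurable_word_determined hF.
have mFA : measurable (F `&` iter k.+1 S @^-1` A).
  by apply: measurableI => //; exact: measurable_preim_shift.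
rewrite (sum_letters mFA) (sum_letters mF) ge0_sume_distrl//.
apply: eq_bigr => j _; rewrite setIAC (branchE _ hF).
have mb := measurable_word_determined (@branch_determined k F j).
have -> : [set o | D o = j] `&` S @^-1` branch k F j `&` iter k.+1 S @^-1` A =
    [set o | D o = j] `&` S @^-1` (branch k F j `&` iter k S @^-1` A).
  by rewrite -setIA; congr (_ `&` _); apply/seteqP; split => o; rewrite /= -iterSr.
rewrite !D_S//; last by apply: measurableI => //; exact: measurable_preim_shift.
by rewrite IH// muleA.
Qed.

End bernoulli_shift.

Section bernoulli_run.
Context {R : realType} {disp : measure_display} {Omega : measurableType disp}
  {P : probability Omega R} {n : nat} {w : nat -> {nonneg R}}
  {D : Omega -> nat} {S : Omega -> Omega}.
Hypothesis D_lt : forall o, (D o < n)%N.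
Hypothesis mD : forall j, measurable [set o | D o = j].
Hypothesis mS : measurable_fun setT S.
Hypothesis D_S : forall j A, (j < n)%N -> measurable A ->
  P ([set o | D o = j] `&` S @^-1` A) = ((w j)%:num%:E * P A)%E.
Context {d : nat}.
Local Notation B := (borelRd R d).
Context {G : nat -> B -> B}.
Hypothesis mG : forall j, measurable_fun setT (G j).
Context {K : oracle R d}.
Hypothesis KE : forall x A, measurable A ->
  K x A = (\sum_(j < n) (w j)%:num * \1_A (G j x))%:E.
Variables (eta : R) (x1 : 'rV[R]_d).

Let iterate (s : seq nat) : 'rV[R]_d :=
  foldl (fun z j => z - eta *: (G j z : 'rV[R]_d)) x1 s.

(** Times start at 1, so [x t] has consumed [t.-1] letters, and [g t] uses the next one, which is
    letter [t.-1] when counted from 0. *)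
Let x t o := iterate (word (D := D) (S := S) t.-1 o).
Let g t o : 'rV[R]_d := G (D (iter t.-1 S o)) (x t o).

Local Notation determined := (word_determined (D := D) (S := S)).

Let x_determined t A : determined t.-1 (x t @^-1` A).
Proof. by move=> o o' E; rewrite /= /x E. Qed.

Let g_determined t A : (1 <= t)%N -> determined t (g t @^-1` A).
Proof.
case: t => // t _ o o'; rewrite !wordSr => /rcons_inj[E1 E2].
by rewrite /= /g /x/= E1 E2.
Qed.

(** An iterate [x s] with [s <= t] depends on [s.-1] letters and a gradient [g s] with [s < t] on
    [s] letters, both at most [t.-1]. *)
Let history_determined t : (1 <= t)%N -> history x g t `<=` determined t.-1.
Proof.
move=> t1; apply: smallest_sub; first exact: sigma_algebra_word_determined.
move=> _ [[s /andP[s1 st] [A mA <-]]|[s /andP[s1 st] [A mA <-]]]; rewrite setTI.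
  apply: (word_determinedW (i := s.-1)); last exact: x_determined.
  by rewrite -ltnS !prednK.
apply: (word_determinedW (i := s)); last exact: g_determined.
by rewrite -ltnS prednK.
Qed.

Let mx t : measurable_fun setT (x t : Omega -> B).
Proof.
move=> _ A mA; rewrite setTI; apply: (measurable_word_determined D_lt mD mS).
exact: x_determined.
Qed.

Let mg t : (1 <= t)%N -> measurable_fun setT (g t : Omega -> B).
Proof.
move=> t1 _ A mA; rewrite setTI; apply: (measurable_word_determined D_lt mD mS).
exact: g_determined.
Qed.

Lemma bernoulli_sgd_run : exists x g : nat -> Omega -> 'rV[R]_d,
  sgd_run eta x1 K P x g.
Proof.
exists x, g; split => //.
  by case=> // t _ o; rewrite /g /x -!pred_Sn wordSr /iterate foldl_rcons.
move=> t t1 A mA.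
have mgA : measurable (g t @^-1` A) by rewrite -[X in measurable X]setTI; exact: mg.
have mind j : measurable_fun setT (fun o => \1_A (G j (x t o)) : R).
  apply: (measurableT_comp (measurable_indic mA)).
  by apply: (measurableT_comp (mG j)); exact: mx.
have YE o : fine (K (x t o) A) = \sum_(j < n) (w j)%:num * \1_A (G j (x t o)).
  by rewrite KE.
split.
- apply: (@ae_bounded_integrable _ _ _ P _ 1); first exact: measurable_indic.
  by apply: aeW => o; rewrite ger0_norm// indicE; case: (_ \in _).
- apply: (@ae_bounded_integrable _ _ _ P _ (\sum_(j < n) (w j)%:num)).
    under eq_fun do rewrite YE.
    by apply: measurable_sum => j; exact: measurable_funM.
  apply: aeW => o; rewrite YE ger0_norm ?sumr_ge0//.
  by apply: ler_sum => j _; rewrite ler_piMr// indicE; case: (_ \in _).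
- move=> C mC; have := history_iterate (x := x) (g := g)
    (A := (fun z => fine (K z A)) @^-1` C) t1.
  apply.
  rewrite -[X in measurable X]setTI.
  have : measurable_fun setT (fun z => fine (K z A)).
    apply: (measurableT_comp (@fine_measurable R setT measurableT)).
    exact: (measurable_kernel K).
  exact.
move=> F hF.
have dF := history_determined t1 hF.
have mF := measurable_word_determined D_lt mD mS dF.
rewrite integral_indic//.
under eq_integral => o _.
  rewrite YE -sumEFin.
  under eq_bigr do rewrite EFinM.
  over.
rewrite ge0_integral_sum//; last first.
  by move=> j; apply: measurable_funeM; apply/measurable_EFinP; exact: measurable_funTS.

(* Split along the letter read at time [t]: where it equals [j], the gradient is [G j (x t)], and
   this letter is independent of every event determined by the first [k] letters, in particular of
   [F] and of the position [x t]. *)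
set k := t.-1.
have mDk j : measurable [set o | D (iter k S o) = j].
  have := @measurable_iter_shift _ _ _ mS k measurableT [set o | D o = j] (mD j).
  by rewrite setTI.
rewrite [RHS](sum_letters (D := D \o iter k S) (fun o => D_lt (iter k S o)) mDk);
  last exact: measurableI.
apply: eq_bigr => j _.
have mGx : measurable ((fun o => G j (x t o)) @^-1` A).
  have := measurableT_comp (mG j) (mx t) measurableT mA.
  by rewrite setTI.
rewrite ge0_integralZl_EFin//; last by apply/measurable_EFinP; exact: measurable_funTS.
rewrite -[X in (_ * X)%E]/(\int[P]_(o in F) (\1_((fun o => G j (x t o)) @^-1` A) o)%:E)%E.
rewrite integral_indic// setIC.
have -> : g t @^-1` A `&` F `&` [set o | (D \o iter k S) o = j] =
    F `&` (fun o => G j (x t o)) @^-1` A `&` iter k S @^-1` [set o | D o = j].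
  apply/seteqP; split => u /=; rewrite /g -/k.
    by move=> [[gA Fu] Dj]; rewrite Dj in gA.
  by move=> [[Fu gA] Dj]; rewrite Dj.
rewrite (word_independent D_lt mD mS D_S)//; last first.
  apply: word_determinedI => //.
  exact: (x_determined (A := G j @^-1` A)).
have := D_S (ltn_ord j) measurableT.
by rewrite preimage_setT setIT probability_setT mule1 => ->; rewrite muleC.
Qed.

End bernoulli_run.

(** * Realization of the shift by Lebesgue measure *)

Lemma lebesgue_measure_affine {R : realType} (a r : R) (E : set R) : 0 < r ->
  measurable E ->
  lebesgue_measure ((fun x => (x - a) / r) @^-1` E) =
  (r%:E * lebesgue_measure E)%E.
Proof.
move=> r0 mE.
pose h : measurableTypeR R -> measurableTypeR R := fun x => (x - a) / r.
have mh : measurable_fun setT h.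
  by apply: measurable_funM => //; apply: measurable_funB.
have r1 : 0 <= r^-1 by rewrite invr_ge0 ltW.
pose m_ : {measure set (measurableTypeR R) -> \bar R} :=
  pushforward lebesgue_measure h.
pose m : {measure set (measurableTypeR R) -> \bar R} :=
  mscale (NngNum r1) (m_ mh).
(* The rescaled pushforward gives every half-open interval its length, so uniqueness identifies it
   with Lebesgue measure. *)
have -> : lebesgue_measure E = m E.
  apply: lebesgue_measure_unique => // _ [[u v] _ <-].
  change (lebesgue_measure `]u, v]%classic =
    ((r^-1)%:E * lebesgue_measure (h @^-1` `]u, v]%classic))%E).
  rewrite (_ : h @^-1` _ = `](r * u + a), (r * v + a)]%classic); last first.
    apply/seteqP; split => x /=; rewrite !in_itv /= /h ltr_pdivlMr// ler_pdivrMr//;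
      by rewrite ![r * _]mulrC ltrBrDr lerBlDr.
  rewrite !lebesgue_measure_itv/= !lte_fin ltrD2r ltr_pM2l//.
  case: ifPn => uv; last by rewrite mule0.
  by rewrite -EFinM; congr EFin; field; rewrite gt_eqF.
change (lebesgue_measure (h @^-1` E) =
  (r%:E * ((r^-1)%:E * lebesgue_measure (h @^-1` E)))%E).
by rewrite muleA -EFinM divff ?gt_eqF// mul1e.
Qed.

Lemma exists_bernoulli_shift {R : realType} (n : nat) (w : nat -> {nonneg R}) :
  \sum_(j < n) (w j)%:num = 1 ->
  exists (disp : measure_display) (Omega : measurableType disp)
    (P : probability Omega R) (D : Omega -> nat) (S : Omega -> Omega),
  [/\ forall o, (D o < n)%N,
      forall j, measurable [set o | D o = j],
      measurable_fun setT S &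
      forall j A, (j < n)%N -> measurable A ->
        P ([set o | D o = j] `&` S @^-1` A) = ((w j)%:num%:E * P A)%E].
Proof.
(* Lebesgue measure on [0, 1[, cut into intervals I j of length w j: D is the index of
   the interval, and S maps each interval affinely onto [0, 1[. *)
move=> w1.
have n0 : (0 < n)%N.
  by case: n w1 => //; rewrite big_ord0 => /eqP; rewrite eq_sym oner_eq0.
pose c j : R := \sum_(i < j) (w i)%:num.
have cS j : c j.+1 = c j + (w j)%:num by rewrite /c big_ord_recr.
have c_le i j : (i <= j)%N -> c i <= c j.
  by apply: (homo_leq (r := fun x y => x <= y)) => // [x y z|k]; [exact: le_trans|rewrite cS lerDl].
pose I j : set R := `[c j, c j.+1[%classic.
have I_inj i j o : I i o -> I j o -> i = j.
  rewrite /I /= !in_itv /= => /andP[i1 i2] /andP[j1 j2].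
  apply/eqP; rewrite eqn_leq; apply/andP; split; rewrite leqNgt; apply/negP => ij.
    by have := le_trans (c_le _ _ ij) i1; rewrite leNgt j2.
  by have := le_trans (c_le _ _ ij) j1; rewrite leNgt i2.
have I_cover m o : 0 <= o -> o < c m -> exists2 j, (j < m)%N & I j o.
  move=> o0; elim: m => [|m IH]; first by rewrite /c big_ord0 ltNge o0.
  have [/IH[j jm Ij] _|cm om] := ltP o (c m); first by exists j => //; exact: ltnW.
  by exists m => //; rewrite /I /= in_itv /= cm.
have mI j : measurable (I j : set (measurableTypeR R)) by exact: measurable_itv.
(* Points outside [[0, 1[] lie in none of the first [n] intervals and get the default letter 0; the
   probability below gives them no mass. *)
pose D (o : R) : nat := if [pick j : 'I_n | `[< I j o >]] is Some j then j else 0%N.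
have DI j o : (j < n)%N -> I j o -> D o = j.
  move=> jn Ij; rewrite /D; case: pickP => [i /asboolP Ii|/(_ (Ordinal jn))].
    exact: I_inj Ii Ij.
  by move/asboolP.
have DE j : [set o | D o = j] = if (j < n)%N then
    I j `|` (if j == 0%N then ~` \big[setU/set0]_(i < n) I i else set0) else set0.
  case: ifPn => jn; last first.
    apply/seteqP; split => // o /= Do; rewrite -{}Do /D in jn.
    by move: jn; case: pickP => [i _|_]; rewrite ?ltn_ord ?n0.
  rewrite -(bigcup_mkord n I).
  apply/seteqP; split => [ o /= <-| o [|]].
  - rewrite /D; case: pickP => [i /asboolP Ii|nI]; first by left.
    by right; rewrite eqxx => -[i /= ni Ii]; have := nI (Ordinal ni) => /asboolP.
  - exact: DI.
  - case: eqP => // -> /= nI; rewrite /D; case: pickP => // i /asboolP Ii.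
    by exfalso; apply: nI; exists i => /=.
have mD j : measurable ([set o | D o = j] : set (measurableTypeR R)).
  rewrite DE; case: ifP => // _; apply: measurableU => //; case: ifP => // _.
  by apply: measurableC; exact: bigsetU_measurable.
have D_lt o : (D o < n)%N.
  by rewrite /D; case: pickP => [i _|_]; rewrite ?ltn_ord ?n0.
pose h j (o : R) := (o - c j) / (w j)%:num.
have mh j : measurable_fun setT (h j : measurableTypeR R -> measurableTypeR R).
  by apply: measurable_funM => //; apply: measurable_funB.
pose S o := h (D o) o.
have mI01 : measurable (`[0, 1[%classic : set (measurableTypeR R)).
  exact: measurable_itv.
pose P0 : {measure set (measurableTypeR R) -> \bar R} := mrestr lebesgue_measure mI01.
have P01 : P0 setT = 1%E.
  by rewrite /P0 /= /mrestr setTI lebesgue_measure_itv/= lte_fin ltr01 sube0.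
pose M := Measure_isProbability.Build _ _ R P0 P01.
pose P : probability (measurableTypeR R) R := HB.pack (P0 : set _ -> \bar R) P0 M.
exists _, (measurableTypeR R), P, D, S; split => //.
  move=> _ A mA; rewrite setTI.
  have -> : S @^-1` A = \big[setU/set0]_(j < n) ([set o | D o = j] `&` h j @^-1` A).
    rewrite -(bigcup_mkord n (fun j => [set o | D o = j] `&` h j @^-1` A)).
    apply/seteqP; split => [ o SA| o [j _ [/= <-]] //].
    by exists (D o) => /=.
  apply: bigsetU_measurable => j _; apply: measurableI => //.
  by rewrite -[X in measurable X]setTI; exact: mh.
move=> j A jn mA.
pose J : set R := `[0, 1[%classic.
change (lebesgue_measure ([set o | D o = j] `&` S @^-1` A `&` J) =
  ((w j)%:num%:E * lebesgue_measure (A `&` J))%E).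
have I01 o : I j o -> 0 <= o < 1.
  rewrite /I /= in_itv /= => /andP[jo oj]; rewrite (le_trans _ jo) ?sumr_ge0//=.
  by rewrite (lt_le_trans oj)// -w1; exact: c_le.
have -> : [set o | D o = j] `&` S @^-1` A `&` J = I j `&` h j @^-1` A.
  rewrite /J; apply/seteqP; split => o /=.
    move=> [[Do SA]]; rewrite in_itv /= => /andP[ o0 o1].
    have [i ni Ii] : exists2 i, (i < n)%N & I i o by apply: I_cover => //; rewrite /c w1.
    by move: SA; rewrite /S Do; split => //; rewrite -Do (DI _ _ ni Ii).
  move=> [Ij hA]; rewrite in_itv /= I01//; split => //.
  by rewrite /S (DI _ _ jn Ij).
(* A letter of weight zero has an empty interval and is set aside, because the affine map [h j]
   divides by the length. *)
have [wj0|wj0] := eqVneq (w j)%:num 0.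
  rewrite wj0 mul0e (_ : I j = set0) ?set0I ?measure0//.
  apply/seteqP; split => // o; rewrite /I /= cS wj0 addr0 in_itv /= => /andP[h1 h2].
  by have := le_lt_trans h1 h2; rewrite ltxx.
have wj : 0 < (w j)%:num by rewrite lt_neqAle eq_sym wj0/=.
rewrite -(lebesgue_measure_affine (c j))//; last exact: measurableI.
congr lebesgue_measure; apply/seteqP; split => o /=; rewrite /J /I /h /= !in_itv /= cS
  ler_pdivlMr// mul0r ltr_pdivrMr// mul1r subr_ge0 ltrBlDl.
  by move=> [].
by move=> [].
Qed.

(** * Smoothness from a quadratic remainder bound *)

Section quadratic_remainder.
Context {R : realType} {d : nat} {f : 'rV[R]_d -> R}
  {D : 'I_d -> 'rV[R]_d -> R} {L : 'I_d -> R}.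
Hypothesis L_ge0 : forall i, 0 <= L i.
Hypothesis remainder : forall x y : 'rV[R]_d,
  `|f y - f x - \sum_(i < d) D i x * (y ord0 i - x ord0 i)|
    <= \sum_(i < d) L i / 2 * `|x ord0 i - y ord0 i| ^+ 2.

(** Along the [i]-th axis the difference quotient differs from [D i x] by at most [L i / 2] times
    the size of the step. *)
Lemma partial_of_remainder i x : partial f i x = D i x.
Proof.
apply: cvg_lim => //.
apply/cvgrPdist_le => /= e e0.
(* Adding 1 keeps the denominator positive when [L i] is zero. *)
have Le : 0 < e / (L i + 1) by rewrite divr_gt0// ltr_wpDl.
near=> h.
have h0 : h != 0 by near: h; exact: nbhs_dnbhs_neq.
have he : `|h| <= e / (L i + 1).
  near: h; apply: dnbhs0_le => //.
have := remainder x (h *: delta_mx ord0 i + x).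
rewrite (bigD1 i)//= big1 => [|k ki]; last first.
  by rewrite !mxE /= (negbTE ki) mulr0 add0r subrr mulr0.
rewrite [in X in _ <= X](bigD1 i)//= [in X in _ <= X]big1 => [|k ki]; last first.
  by rewrite !mxE /= (negbTE ki) mulr0 add0r subrr normr0 expr0n mulr0.
rewrite !mxE !eqxx /= !mulr1 !addr0 addrK opprD addrCA subrr addr0 normrN => Hr.
rewrite distrC /GRing.scale /=.
have -> : h^-1 * (f (h *: delta_mx ord0 i + x) - f x) - D i x =
    h^-1 * (f (h *: delta_mx ord0 i + x) - f x - D i x * h) by field.
rewrite normrM normfV ler_pdivrMl ?normr_gt0//.
apply: (le_trans Hr); rewrite expr2 mulrA mulrC ler_wpM2l//.
apply: (@le_trans _ _ ((L i + 1) * `|h|)).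
  by rewrite ler_wpM2r//; have := L_ge0 i; lra.
by rewrite -ler_pdivlMl ?ltr_wpDl// mulrC.
Unshelve. all: by end_near. Qed.

(** In the sup norm the remainder is at most [M * |v| ^ 2], with [M] the sum of the [L i / 2]; this
    is little-o of [v]. *)
Lemma differentiable_of_remainder x : differentiable f x.
Proof.
pose dfx (v : 'rV[R]_d) : R := \sum_(i < d) D i x * v ord0 i.
have dfx_lin : linear dfx.
  move=> a u v; rewrite /dfx scaler_sumr -big_split /=; apply: eq_bigr => i _.
  by rewrite !mxE /GRing.scale /=; ring.
pose df : {linear 'rV[R]_d -> R} := HB.pack dfx (GRing.isLinear.Build _ _ _ _ dfx dfx_lin).
have dfc : continuous df.
  rewrite /df /= /dfx.
  apply: (continuous_big (op := +%R) (x0 := 0)) => [|i _]; first exact: add_continuous.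
  by move=> v; apply: (cvgM (cvg_cst (D i x)) (@coord_continuous _ _ _ ord0 i v)).
have fE : f \o shift x = cst (f x) + df +o_ 0 id.
  apply/eqaddoP => e e0.
  pose M := \sum_(i < d) L i / 2.
  have M0 : 0 <= M by apply: sumr_ge0 => i _; rewrite divr_ge0.
  have eM : 0 < e / (M + 1) by rewrite divr_gt0// ltr_wpDl.
  have small : \forall v \near (0 : 'rV[R]_d), `|v| <= e / (M + 1) := nbhs0_le eM.
  near=> v.
  have ve : `|v| <= e / (M + 1).
    by near: v; exact: small.
  have := remainder x (v + x).
  rewrite (eq_bigr (fun i => D i x * v ord0 i)); last by move=> i _; rewrite !mxE addrK.
  rewrite /= !fctE /= opprD addrA => /le_trans; apply.
  rewrite (@le_trans _ _ (M * `|v| ^+ 2))//.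
    rewrite /M mulr_suml; apply: ler_sum => i _.
    apply: ler_wpM2l; first by rewrite divr_ge0.
    rewrite lerXn2r ?nnegrE// !mxE opprD addrCA subrr addr0 normrN.
    by rewrite -[leRHS]/(mx_norm v) mx_normrE;
      apply: (le_bigmax _ (fun ij => `|v ij.1 ij.2|) (ord0, i)).
  rewrite expr2 mulrA ler_wpM2r//.
  apply: (@le_trans _ _ ((M + 1) * `|v|)); first by rewrite ler_wpM2r// lerDl.
  by rewrite -ler_pdivlMl ?ltr_wpDl// mulrC.
have dE := diff_unique dfc fE.
by apply/diff_locallyP; rewrite dE; split.
Unshelve. all: by end_near. Qed.

Lemma coordinate_smooth_of_remainder : coordinate_smooth L f.
Proof.
split; first exact: differentiable_of_remainder.
move=> x y; apply: le_trans (remainder x y).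
by under eq_bigr do rewrite partial_of_remainder.
Qed.

End quadratic_remainder.

(** * Lower bounds along an invariant *)

Section min_upto.
Context {R : realType}.

Lemma min_upto_ge (T : nat) (v : nat -> R) (m : R) : (1 <= T)%N ->
  (forall t, (1 <= t <= T)%N -> m <= v t) -> m <= min_upto T v.
Proof.
move=> T1 mv; rewrite /min_upto big_seq.
apply: (big_ind (fun z => m <= z)); first by apply: mv; rewrite leqnn.
  by move=> a b ma mb; rewrite le_min ma.
by move=> t; rewrite mem_index_iota ltnS => /mv.
Qed.

Lemma measurable_min_upto {disp : measure_display} {Omega : measurableType disp}
    (T : nat) (v : nat -> Omega -> R) :
  (forall t, (1 <= t)%N -> measurable_fun setT (v t)) ->
  measurable_fun setT (fun o => min_upto T (v^~ o)).
Proof.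
move=> mv; rewrite /min_upto.
have : all (leq 1) (index_iota 1 T.+1).
  by apply/allP => t; rewrite mem_index_iota => /andP[].
elim: (index_iota _ _) => [_|t s IH /= /andP[t1 /IH ms]].
  by under eq_fun do rewrite big_nil; exact: mv.
under eq_fun do rewrite big_cons.
by apply: measurable_minr => //; exact: mv.
Qed.

End min_upto.

Section mixture_run_bounds.
Context {R : realType} {d : nat}.
Local Notation B := (borelRd R d).
Context {f : 'rV[R]_d -> R} {D : 'I_d -> 'rV[R]_d -> R} {L sigma : 'I_d -> R}.
Hypothesis L_ge0 : forall i, 0 <= L i.
Hypothesis remainder : forall x y : 'rV[R]_d,
  `|f y - f x - \sum_(i < d) D i x * (y ord0 i - x ord0 i)|
    <= \sum_(i < d) L i / 2 * `|x ord0 i - y ord0 i| ^+ 2.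
Context {n : nat} {w : nat -> {nonneg R}} {G : nat -> B -> B}.
Hypothesis mG : forall j, measurable_fun setT (G j).
Hypothesis mean_G : forall i x,
  D i x = \sum_(j < n) (w j)%:num * (G j x : 'rV[R]_d) ord0 i.
Context {eta : R} {x1 : 'rV[R]_d} {Q : nat -> 'I_d -> set R}.
Hypothesis mQ : forall t i, measurable (Q t i).
Hypothesis Q1 : forall i, Q 1 i (x1 ord0 i).
Hypothesis QS : forall t (z : 'rV[R]_d), (1 <= t)%N -> (forall i, Q t i (z ord0 i)) ->
  forall (j : 'I_n) i, Q t.+1 i (z ord0 i - eta * (G j z : 'rV[R]_d) ord0 i).
Hypothesis Q_bounded : forall t, (1 <= t)%N -> exists b,
  forall z : 'rV[R]_d, (forall i, Q t i (z ord0 i)) ->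
  forall (j : 'I_n) i, `|(G j z : 'rV[R]_d) ord0 i| <= b.
Hypothesis Q_variance : forall t (z : 'rV[R]_d), (1 <= t)%N ->
  (forall i, Q t i (z ord0 i)) -> forall i,
  \sum_(j < n) (w j)%:num * `|(G j z : 'rV[R]_d) ord0 i - D i z| ^+ 2 <= sigma i ^+ 2.
Context {T : nat} {m : R}.
Hypothesis T_gt0 : (1 <= T)%N.
Hypothesis m_ge0 : 0 <= m.
Hypothesis Q_gradient : forall t (z : 'rV[R]_d), (1 <= t <= T)%N ->
  (forall i, Q t i (z ord0 i)) -> m <= \sum_(i < d) `|D i z|.
Context {K : oracle R d}.
Hypothesis KE : forall x A, measurable A ->
  K x A = (\sum_(j < n) (w j)%:num * \1_A (G j x))%:E.
Context {disp : measure_display} {Omega : measurableType disp}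
  {P : probability Omega R} {x g : nat -> Omega -> 'rV[R]_d}.
Hypothesis run : sgd_run eta x1 K P x g.

Let partialE i z : partial f i z = D i z := partial_of_remainder L_ge0 remainder i z.

Let mD i : measurable_fun [set: B] (D i : B -> R).
Proof.
rewrite (_ : D i = fun z => \sum_(j < n) (w j)%:num * (G j z : 'rV[R]_d) ord0 i).
  apply: measurable_sum => j; apply: measurable_funM => //.
  exact: (measurableT_comp (borel_coord i) (mG j)).
by apply/funext => z; exact: mean_G.
Qed.

Lemma mixture_unbiased : unbiased f P x g.
Proof.
move=> t i t1; have [b Gb] := Q_bounded t1.
have -> : (fun o => partial f i (x t o)) =
    fun o => \sum_(j < n) (w j)%:num * (G j (x t o) : 'rV[R]_d) ord0 i.
  by apply/funext => o; rewrite partialE mean_G.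
apply: (cond_exp_mixture mG KE run mQ Q1 QS t1
  (phi := fun z => (z.2 : 'rV[R]_d) ord0 i) (b := b)).
  exact: (measurableT_comp (borel_coord i) measurable_snd).
by move=> z Qz j; exact: Gb.
Qed.

Lemma mixture_variance : coordinate_variance_le sigma f P x g.
Proof.
move=> t i t1; have [b Gb] := Q_bounded t1.
exists (fun o => \sum_(j < n) (w j)%:num *
  `|(G j (x t o) : 'rV[R]_d) ord0 i - D i (x t o)| ^+ 2); split; last first.
  by apply: filterS (ae_invariant mG KE run mQ Q1 QS t1) => o Qo; exact: Q_variance Qo i.
under [X in is_cond_exp _ _ X _]eq_fun do rewrite partialE.
(* As [D i] is a weighted sum of gradients bounded by [b], it is bounded by [c] on the invariant
   set, and the deviation by [b + c]. *)
pose c := \sum_(j < n) (w j)%:num * b.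
apply: (cond_exp_mixture mG KE run mQ Q1 QS t1
  (phi := fun z => `|(z.2 : 'rV[R]_d) ord0 i - D i z.1| ^+ 2) (b := (b + c) ^+ 2)).
  apply: measurable_funX; apply: measurableT_comp => //; apply: measurable_funB.
    exact: (measurableT_comp (borel_coord i) measurable_snd).
  exact: (measurableT_comp (mD i) measurable_fst).
move=> z Qz j.
have b0 : 0 <= b by rewrite (le_trans _ (Gb z Qz j i)).
have c0 : 0 <= c by apply: sumr_ge0 => k _; rewrite mulr_ge0.
rewrite ger0_norm ?sqr_ge0//= lerXn2r ?nnegrE ?addr_ge0//.
rewrite (le_trans (ler_normB _ _))// lerD//; first exact: Gb.
rewrite mean_G (le_trans (ler_norm_sum _ _ _))//; apply: ler_sum => k _.
by rewrite normrM ger0_norm// ler_wpM2l//; exact: Gb.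
Qed.

Lemma mixture_gradient_ge :
  (m%:E <= 'E_P[fun o => min_upto T (fun t => grad_l1norm f (x t o))])%E.
Proof.
rewrite expectation.unlock.
pose X o := min_upto T (fun t => grad_l1norm f (x t o)).
change (m%:E <= \int[P]_o (X o)%:E)%E.
have XE : X = fun o => min_upto T (fun t => \sum_(i < d) `|D i (x t o)|).
  apply/funext => o; rewrite /X; congr min_upto; apply/funext => t.
  by apply: eq_bigr => i _; rewrite partialE.
have mX : measurable_fun setT X.
  rewrite XE; apply: (@measurable_min_upto _ _ _ T (fun t o => \sum_(i < d) `|D i (x t o)|)).
  move=> t t1; apply: measurable_sum => i; apply: measurableT_comp => //.
  exact: (measurableT_comp (mD i) (sgd_measurable_x run t1)).
have X0 o : 0 <= X o.
  by rewrite XE; apply: min_upto_ge => // t _; exact: sumr_ge0.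
(* The maximum with [m] is at least [m] everywhere and equals [X] almost everywhere, so both have
   the same expectation. *)
have mXm : measurable_fun setT (fun o => Num.max m (X o)) by exact: measurable_maxr.
have Xm : {ae P, forall o, m <= X o}.
  have : {ae P, forall o, forall t, (1 <= t)%N -> forall i, Q t i (x t o ord0 i)}.
    apply: ae_foralln => t; have [t0|t1] := leqP t 0.
      by apply: aeW => o; move: t0; rewrite leqn0 => /eqP ->.
    by apply: filterS (ae_invariant mG KE run mQ Q1 QS t1) => o ? _.
  apply: filterS => o Qo; rewrite XE; apply: min_upto_ge => // t /andP[t1 tT].
  by apply: (Q_gradient (t := t)); [rewrite t1|exact: Qo].
rewrite (@ge0_ae_eq_integral _ _ _ P setT _ (fun o => (Num.max m (X o))%:E))//.
- have -> : m%:E = (\int[P]_o (cst m%:E o))%E.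
    by rewrite integral_cst//= probability_setT mule1.
  apply: ge0_le_integral => //.
  + exact/measurable_EFinP.
  + by move=> o _; rewrite lee_fin le_max lexx.
- exact/measurable_EFinP.
- exact/measurable_EFinP.
- by move=> o _; rewrite lee_fin X0.
- by move=> o _; rewrite lee_fin le_max m_ge0.
- by apply: filterS Xm => o mXo _; congr EFin; apply/esym/max_idPr.
Qed.

End mixture_run_bounds.

(** * Separable hard instances *)

Lemma row_continuous {R : realType} {d : nat} {T : topologicalType}
    (c : 'I_d -> T -> R) :
  (forall i, continuous (c i)) -> continuous (fun x => \row_i c i x : 'rV[R]_d).
Proof.
move=> cc.
rewrite (_ : (fun x => _) = fun x => \sum_(i < d) c i x *:
    (delta_mx ord0 i : 'rV[R]_d)); last first.
  apply/funext => x; rewrite [LHS]row_sum_delta.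
  by apply: eq_bigr => i _; rewrite mxE.
pose F i x := c i x *: (delta_mx ord0 i : 'rV[R]_d).
have cF i : continuous (F i) by move=> x; apply: cvgZr_tmp; exact: cc.
have := @continuous_big _ _ _ (0 : 'rV[R]_d) xpredT (@add_continuous 'rV[R]_d) _
  (index_enum 'I_d) F (fun i _ => cF i).
exact.
Qed.

(** The conclusion of the theorem with its lower bound left free as [m], so that the choice of an
    instance reduces to comparing numbers. Existence of a run keeps the claim about all runs from
    being vacuous. *)
Definition hard_instance (R : realType) (d : nat) (L sigma : 'I_d -> R)
    (Delta eta : R) (T : nat) (m : R) : Prop :=
  exists (f : 'rV[R]_d -> R) (x1 : 'rV[R]_d) (K : oracle R d),
  [/\ coordinate_smooth L f,
      initial_gap_le f x1 Delta,
      (exists (disp : measure_display) (Omega : measurableType disp)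
              (P : probability Omega R) (x g : nat -> Omega -> 'rV[R]_d),
         sgd_run eta x1 K P x g) &
      forall (disp : measure_display) (Omega : measurableType disp)
             (P : probability Omega R) (x g : nat -> Omega -> 'rV[R]_d),
        sgd_run eta x1 K P x g ->
        [/\ unbiased f P x g,
            coordinate_variance_le sigma f P x g &
            (m%:E <= 'E_P[fun w => min_upto T (fun t => grad_l1norm f (x t w))])%E]].

(* Q t i is a set in which coordinate i of the t-th iterate stays almost surely; the
   oracle at z draws (c j i (z_i))_i with probability w j. *)
Section separable_instance.
Context {R : realType} {d : nat} {L sigma : 'I_d -> R} {Delta eta : R} {T n : nat}.
Context {h dh : 'I_d -> R -> R} {w : nat -> R} {c : nat -> 'I_d -> R -> R}
  {x1 : 'I_d -> R} {Q : nat -> 'I_d -> set R} {m : 'I_d -> R}.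
Hypothesis L_ge0 : forall i, 0 <= L i.
Hypothesis remainder : forall i x y,
  `|h i y - h i x - dh i x * (y - x)| <= L i / 2 * `|x - y| ^+ 2.
Hypothesis h_ge0 : forall i s, 0 <= h i s.
Hypothesis gap : \sum_(i < d) h i (x1 i) <= Delta.
Hypothesis w_ge0 : forall j, 0 <= w j.
Hypothesis w_sum : \sum_(j < n) w j = 1.
Hypothesis c_continuous : forall j i, continuous (c j i).
Hypothesis c_mean : forall i s, \sum_(j < n) w j * c j i s = dh i s.
Hypothesis mQ : forall t i, measurable (Q t i).
Hypothesis Q1 : forall i, Q 1 i (x1 i).
Hypothesis QS : forall t i s, (1 <= t)%N -> Q t i s ->
  forall j : 'I_n, Q t.+1 i (s - eta * c j i s).
Hypothesis Q_bounded : forall t, (1 <= t)%N -> exists b,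
  forall i s, Q t i s -> forall j : 'I_n, `|c j i s| <= b.
Hypothesis Q_variance : forall t i s, (1 <= t)%N -> Q t i s ->
  \sum_(j < n) w j * `|c j i s - dh i s| ^+ 2 <= sigma i ^+ 2.
Hypothesis T_gt0 : (1 <= T)%N.
Hypothesis m_ge0 : forall i, 0 <= m i.
Hypothesis Q_gradient : forall t i s, (1 <= t <= T)%N -> Q t i s ->
  m i <= `|dh i s|.

Lemma separable_instance :
  hard_instance L sigma Delta eta T (\sum_(i < d) m i).
Proof.
pose f (x : 'rV[R]_d) := \sum_(i < d) h i (x ord0 i).
pose D i (x : 'rV[R]_d) := dh i (x ord0 i).
pose x1v : 'rV[R]_d := \row_i x1 i.
pose G j (x : borelRd R d) : borelRd R d := \row_i c j i ((x : 'rV[R]_d) ord0 i).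
have GE j x i : (G j x : 'rV[R]_d) ord0 i = c j i (x ord0 i) by rewrite mxE.
pose wn j := NngNum (w_ge0 j).
have mG j : measurable_fun setT (G j).
  apply: borel_endo_continuous; apply: row_continuous => i x.
  by apply: continuous_comp; [exact: coord_continuous|exact: c_continuous].
have wn1 : \sum_(j < n) (wn j)%:num = 1 by rewrite -w_sum; apply: eq_bigr.
have [K KE] := mixture_oracle mG wn1.
have rem (x y : 'rV[R]_d) : `|f y - f x - \sum_(i < d) D i x * (y ord0 i - x ord0 i)|
    <= \sum_(i < d) L i / 2 * `|x ord0 i - y ord0 i| ^+ 2.
  rewrite /f -!sumrB; apply: le_trans (ler_norm_sum _ _ _) _.
  by apply: ler_sum => i _; exact: remainder.
have mean i x : D i x = \sum_(j < n) (wn j)%:num * (G j x : 'rV[R]_d) ord0 i.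
  by rewrite /D -c_mean; apply: eq_bigr => j _; rewrite GE.
have Qv1 i : Q 1 i (x1v ord0 i) by rewrite mxE.
have QvS t (z : 'rV[R]_d) : (1 <= t)%N -> (forall i, Q t i (z ord0 i)) ->
    forall (j : 'I_n) i, Q t.+1 i (z ord0 i - eta * (G j z : 'rV[R]_d) ord0 i).
  by move=> t1 Qz j i; rewrite GE; exact: QS.
have Qb t : (1 <= t)%N -> exists b, forall z : 'rV[R]_d,
    (forall i, Q t i (z ord0 i)) ->
    forall (j : 'I_n) i, `|(G j z : 'rV[R]_d) ord0 i| <= b.
  move=> /Q_bounded[b Qb]; exists b => z Qz j i; rewrite GE; exact: Qb.
have Qvar t (z : 'rV[R]_d) : (1 <= t)%N -> (forall i, Q t i (z ord0 i)) -> forall i,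
    \sum_(j < n) (wn j)%:num * `|(G j z : 'rV[R]_d) ord0 i - D i z| ^+ 2 <= sigma i ^+ 2.
  move=> t1 Qz i; under eq_bigr do rewrite GE; exact: Q_variance (Qz i).
have Qgrad t (z : 'rV[R]_d) : (1 <= t <= T)%N -> (forall i, Q t i (z ord0 i)) ->
    \sum_(i < d) m i <= \sum_(i < d) `|D i z|.
  by move=> tT Qz; apply: ler_sum => i _; exact: Q_gradient (Qz i).
have M0 : 0 <= \sum_(i < d) m i by exact: sumr_ge0.
exists f, x1v, K; split.
- exact: coordinate_smooth_of_remainder rem.
- rewrite /initial_gap_le; apply: (@le_trans _ _ (f x1v)%:E).
    rewrite -[leRHS]adde0; apply: leeD2l; rewrite oppe_le0.
    apply: le_ereal_inf_tmp => _ [y _ <-]; rewrite lee_fin /f.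
    exact: sumr_ge0.
  by rewrite lee_fin /f; under eq_bigr do rewrite mxE.
- have [disp [ Omega [P [Dg [S [D_lt mD mS D_S]]]]]] := exists_bernoulli_shift wn1.
  exists disp, Omega, P.
  exact: (bernoulli_sgd_run D_lt mD mS D_S mG KE eta x1v).
move=> disp Omega P x g run; split.
- exact: (mixture_unbiased L_ge0 rem mG mean mQ Qv1 QvS Qb KE run).
- exact: (mixture_variance L_ge0 rem mG mean mQ Qv1 QvS Qb Qvar KE run).
- exact: (mixture_gradient_ge L_ge0 rem mG mean mQ Qv1 QvS T_gt0 M0 Qgrad KE run).
Qed.

End separable_instance.

(** * Hard instances *)

Section one_dimensional.
Context {R : realType}.
Implicit Types L l g eta x y : R.

Lemma quadratic_remainder l L x y : 0 <= l -> l <= L ->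
  `|l / 2 * y ^+ 2 - l / 2 * x ^+ 2 - l * x * (y - x)| <= L / 2 * `|x - y| ^+ 2.
Proof.
move=> l0 lL; rewrite real_normK ?num_real//.
have -> : l / 2 * y ^+ 2 - l / 2 * x ^+ 2 - l * x * (y - x) = l / 2 * (x - y) ^+ 2.
  by field.
rewrite ger0_norm; last by rewrite mulr_ge0 ?sqr_ge0 ?divr_ge0.
by apply: ler_wpM2r; rewrite ?sqr_ge0// ler_pM2r.
Qed.

(** A one-sided Huber function: it stays quadratic on the whole left of [b] and is linear only on
    the right, where the iterates live. Its derivative is [L * Num.min x b]. *)
Definition huber L b x : R :=
  if x <= b then L / 2 * x ^+ 2 else L * b * x - L / 2 * b ^+ 2.

Lemma huber_ge0 L b x : 0 <= L -> 0 <= b -> 0 <= huber L b x.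
Proof.
move=> L0 b0; rewrite /huber; case: (leP x b) => xb; first by rewrite mulr_ge0 ?divr_ge0 ?sqr_ge0.
have -> : L * b * x - L / 2 * b ^+ 2 = L / 2 * (b * (x - b) + b * x) by field.
rewrite mulr_ge0 ?divr_ge0// addr_ge0// mulr_ge0//; last exact: le_trans (ltW xb).
by rewrite subr_ge0 ltW.
Qed.

(** In each position of [x] and [y] relative to [b], the remainder is [L / 2] times some [u] between
    0 and [(x - y) ^+ 2]. *)
Lemma huber_remainder L b x y : 0 <= L ->
  `|huber L b y - huber L b x - L * Num.min x b * (y - x)| <= L / 2 * `|x - y| ^+ 2.
Proof.
move=> L0; rewrite real_normK ?num_real// /huber /Num.min.
have L2 : 0 <= L / 2 by rewrite divr_ge0.
have scaled z u : z = L / 2 * u -> 0 <= u -> u <= (x - y) ^+ 2 ->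
    `|z| <= L / 2 * (x - y) ^+ 2.
  by move=> -> u0 ule; rewrite ger0_norm ?mulr_ge0// ler_wpM2l.
case: (leP y b) => yb; case: (ltP x b) => xb.
- rewrite (ltW xb); apply: (scaled _ ((x - y) ^+ 2)); rewrite ?sqr_ge0//.
  by field.
- case: (leP x b) => xb'.
    apply: (scaled _ ((x - y) ^+ 2)); rewrite ?sqr_ge0//.
    have -> : x = b by apply/le_anti; rewrite xb xb'.
    by field.
  apply: (scaled _ ((b - y) ^+ 2)); rewrite ?sqr_ge0//; first by field.
  nra.
- rewrite (ltW xb); apply: (scaled _ ((b - x) * (2 * (y - b) + (b - x)))); first by field.
    by apply: mulr_ge0; lra.
  nra.
- case: (leP x b) => xb'.
    apply: (scaled _ 0); rewrite ?sqr_ge0//.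
    have -> : x = b by apply/le_anti; rewrite xb xb'.
    by field.
  apply: (scaled _ 0); rewrite ?sqr_ge0//; by field.
Qed.

End one_dimensional.

Section instances.
Context {R : realType} {d : nat} {L sigma : 'I_d -> R} {Delta eta : R} {T : nat}.
Hypothesis L_gt0 : forall i, 0 < L i.
Hypothesis eta_gt0 : 0 < eta.
Hypothesis T_gt0 : (1 <= T)%N.

(** A mixture with a single letter is a noiseless oracle; with the singleton invariant made of the
    exact trajectory, everything reduces to a scalar recursion. The iterate at time [t] is the
    [t.-1]-fold iteration. *)
Lemma deterministic_instance (h dh : 'I_d -> R -> R) (x1 m : 'I_d -> R) :
  (forall i x y, `|h i y - h i x - dh i x * (y - x)| <= L i / 2 * `|x - y| ^+ 2) ->
  (forall i s, 0 <= h i s) ->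
  \sum_(i < d) h i (x1 i) <= Delta ->
  (forall i, continuous (dh i)) ->
  (forall i, 0 <= m i) ->
  (forall i k, (k < T)%N -> m i <= `|dh i (iter k (fun s => s - eta * dh i s) (x1 i))|) ->
  hard_instance L sigma Delta eta T (\sum_(i < d) m i).
Proof.
move=> rem h0 gap cdh m0 grad.
pose traj i k := iter k (fun s => s - eta * dh i s) (x1 i).
apply: (@separable_instance _ _ _ _ _ _ _ 1 h dh (fun=> 1) (fun=> dh) x1
  (fun t i => [set traj i t.-1])) => //.
- by move=> i; exact: ltW.
- by rewrite big_ord1.
- by move=> i s; rewrite big_ord1 mul1r.
- by case=> // t i s _ ->.
- move=> t t1; exists (\sum_i `|dh i (traj i t.-1)|) => i s -> _.
  by rewrite (bigD1 i)//= lerDl sumr_ge0.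
- by move=> t i s _ _; rewrite big_ord1 subrr normr0 expr0n mulr0 sqr_ge0.
- by move=> t i s /andP[t1 tT] ->; apply: grad; rewrite prednK.
Qed.

Lemma divergent_instance (i0 : 'I_d) : 0 <= Delta -> 2 <= eta * L i0 ->
  hard_instance L sigma Delta eta T (Num.sqrt (2 * L i0 * Delta)).
Proof.
move=> D0 eL.
pose l i := if i == i0 then L i else 0.
have l0 i : 0 <= l i by rewrite /l; case: ifP => // _; exact: ltW.
have lL i : l i <= L i by rewrite /l; case: ifP => // _; exact: ltW.
(* Chosen so that [L i0 / 2 * r ^+ 2] is exactly [Delta]. *)
pose r := Num.sqrt (2 * Delta / L i0).
have Lr : L i0 * r = Num.sqrt (2 * L i0 * Delta).
  rewrite -[X in X * _]ger0_norm ?ltW// -sqrtr_sqr -sqrtrM ?sqr_ge0//.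
  by congr Num.sqrt; field; rewrite gt_eqF.
have -> : Num.sqrt (2 * L i0 * Delta) =
    \sum_(i < d) if i == i0 then Num.sqrt (2 * L i0 * Delta) else 0.
  by rewrite -big_mkcond big_pred1_eq.
apply: (@deterministic_instance (fun i s => l i / 2 * s ^+ 2) (fun i s => l i * s)
  (fun=> r)).
- by move=> i x y; exact: quadratic_remainder.
- by move=> i s; rewrite mulr_ge0 ?divr_ge0 ?sqr_ge0.
- rewrite (bigD1 i0)//= big1 ?addr0 => [|i /negbTE ii]; last by rewrite /l ii !mul0r.
  rewrite /l eqxx sqr_sqrtr; last by rewrite divr_ge0 ?mulr_ge0// ltW.
  by rewrite le_eqVlt; apply/orP; left; apply/eqP; field; rewrite gt_eqF.
- by move=> i x; apply: cvgM; [exact: cvg_cst|exact: cvg_id].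
- by move=> i; case: ifP => // _; exact: sqrtr_ge0.
move=> i k _; case: eqP => [->|_]; last exact: normr_ge0.
(* The multiplier [1 - eta * L i0] is at most -1, so the distance to the minimizer never
   decreases. *)
have -> : iter k (fun s => s - eta * (l i0 * s)) r = (1 - eta * L i0) ^+ k * r.
  elim: k => [|k IH]; first by rewrite mul1r.
  by rewrite iterS IH exprS /l eqxx; ring.
rewrite /l eqxx normrM [`|L i0|]gtr0_norm// normrM normrX -Lr.
apply: ler_wpM2l; first exact: ltW.
rewrite [`|r|]ger0_norm ?sqrtr_ge0//; apply: ler_peMl; first exact: sqrtr_ge0.
by apply: exprn_ege1; rewrite ler0_norm; lra.
Qed.

(** Each step on the slope moves a coordinate by [eta * g], so a start at distance [eta * g * T] to
    the right of the break point keeps all [T] iterates on it. The two summands of the gap are the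
    descent along the slope and the height of the quadratic part. *)
Lemma plateau_instance (g : R) : 0 <= g ->
  \sum_(i < d) (eta * g ^+ 2 * T%:R + g ^+ 2 / (2 * L i)) <= Delta ->
  hard_instance L sigma Delta eta T (d%:R * g).
Proof.
move=> g0 gap.
have -> : d%:R * g = \sum_(i < d) g by rewrite sumr_const card_ord mulr_natl.
have egT : 0 <= eta * g * T%:R by rewrite !mulr_ge0// ltW.
pose b i := g / L i.
have b0 i : 0 <= b i by rewrite divr_ge0// ltW.
have Lb i : L i * b i = g by rewrite /b mulrC divfK// gt_eqF.
apply: (@deterministic_instance (fun i => huber (L i) (b i))
  (fun i s => L i * Num.min s (b i)) (fun i => b i + eta * g * T%:R)) => //.
- by move=> i x y; apply: huber_remainder; exact: ltW.
- by move=> i s; apply: huber_ge0 => //; exact: ltW.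
- apply: le_trans gap; apply: ler_sum => i _.
  have Li := L_gt0 i.
  have gb : g ^+ 2 / (2 * L i) = L i / 2 * b i ^+ 2.
    by rewrite /b; field; rewrite gt_eqF.
  rewrite gb /huber; case: (leP _ (b i)) => [xb|_].
    (* The start lies in the quadratic branch only when its distance to the break point is zero. *)
    have -> : eta * g * T%:R = 0 by apply/le_anti; rewrite egT andbT; lra.
    by rewrite addr0 lerDr !mulr_ge0 ?sqr_ge0// ltW.
  rewrite le_eqVlt; apply/orP; left; apply/eqP.
  by move: (b i) (Lb i) => bi <-; field.
- move=> i x; apply: cvgM; first exact: cvg_cst.
  apply: (@min_fun_continuous _ R R id (cst (b i))) => //; last exact: cst_continuous.
  by move=> y; exact: cvg_id.
move=> i k kT.
have traj j : (j <= T)%N -> iter j (fun s => s - eta * (L i * Num.min s (b i)))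
    (b i + eta * g * T%:R) = b i + eta * g * (T - j)%:R.
  elim: j => [|j IH] jT; first by rewrite subn0.
  rewrite iterS IH ?(ltnW jT)// min_r ?lerDl ?mulr_ge0 ?(ltW eta_gt0)// Lb.
  by rewrite !natrB// ?(ltnW jT)// -natr1; ring.
rewrite traj ?(ltnW kT)// min_r ?lerDl ?mulr_ge0 ?(ltW eta_gt0)// Lb.
by rewrite ger0_norm.
Qed.

Lemma flip_instance (l a : 'I_d -> R) :
  (forall i, 0 <= l i <= L i) -> (forall i, 0 <= a i) ->
  \sum_(i < d) eta * l i / 2 <= 1 ->
  \sum_(i < d) l i / 2 * a i ^+ 2 <= Delta ->
  (forall i, 2 * l i * a i ^+ 2 <= eta * sigma i ^+ 2) ->
  hard_instance L sigma Delta eta T (\sum_(i < d) l i * a i).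
Proof.
move=> lL a0 p1 gap var.
have l0 i : 0 <= l i by have /andP[] := lL i.
pose p i := eta * l i / 2.
have p0 i : 0 <= p i by rewrite divr_ge0 ?mulr_ge0 ?(ltW eta_gt0).
(* Letter i < d flips the sign of coordinate i, the last letter d leaves x unchanged. *)
pose w j := if insub j : option 'I_d is Some i then p i else 1 - \sum_(i < d) p i.
have wi (i : 'I_d) : w i = p i by rewrite /w valK.
have w_sum : \sum_(j < d.+1) w j = 1.
  rewrite big_ord_recr /= {2}/w insubF ?ltnn//.
  have -> : \sum_(i < d) w (widen_ord (leqnSn d) i) = \sum_(i < d) p i.
    by apply: eq_bigr => i _; exact: wi.
  by rewrite addrCA subrr addr0.
(* The gradient [2 / eta * s] moves [s] to [- s]; drawn with probability [eta * l i / 2], it has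
   mean [l i * s]. *)
pose c (j : nat) (i : 'I_d) s := if j == i :> nat then 2 / eta * s else 0.
have avg (i : 'I_d) (u v : R) :
    \sum_(j < d.+1) w j * (if j == i :> nat then u else v) = p i * u + (1 - p i) * v.
  rewrite (eq_bigr (fun j : 'I_d.+1 => w j * v + if j == lift ord_max i then p i * (u - v) else 0)).
    rewrite big_split /= -mulr_suml w_sum -big_mkcond big_pred1_eq; ring.
  move=> j _; rewrite -val_eqE /= /bump leqNgt ltn_ord add0n.
  case: eqP => [ji|_]; last by rewrite addr0.
  by rewrite ji wi; ring.
have etaE : eta != 0 by rewrite gt_eqF.
apply: (@separable_instance _ _ _ _ _ _ _ d.+1 (fun i s => l i / 2 * s ^+ 2)
  (fun i s => l i * s) w c a (fun _ i => [set s | `|s| = a i])) => //.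
- by move=> i; exact: ltW.
- by move=> i x y; apply: quadratic_remainder => //; have /andP[] := lL i.
- by move=> i s; rewrite mulr_ge0 ?divr_ge0 ?sqr_ge0.
- by move=> j; rewrite /w; case: insub => // ; rewrite subr_ge0.
- move=> j i x; rewrite /c; case: eqP => _; last exact: cvg_cst.
  by apply: cvgM; [exact: cvg_cst|exact: cvg_id].
- by move=> i s; rewrite /c avg /p; field.
- move=> t i; rewrite -[X in measurable X]setTI.
  exact: (@normr_measurable R setT measurableT [set a i] (measurable_set1 _)).
- by move=> i; rewrite /= ger0_norm.
- move=> t i s _ /= sa j; rewrite /c; case: eqP => _; last by rewrite mulr0 subr0.
  by rewrite (_ : s - _ = - s) ?normrN//; field.
- move=> t _; exists (\sum_i 2 / eta * a i) => i s /= sa j.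
  have ea k : 0 <= 2 / eta * a k by rewrite mulr_ge0// divr_ge0// ltW.
  rewrite /c; case: eqP => _; last by rewrite normr0 sumr_ge0.
  rewrite normrM sa ger0_norm ?divr_ge0 ?(ltW eta_gt0)//.
  by rewrite (bigD1 i)//= lerDl sumr_ge0.
- move=> t i s _ /= sa.
  have sE : s ^+ 2 = a i ^+ 2 by rewrite -sa real_normK ?num_real.
  rewrite (eq_bigr (fun j : 'I_d.+1 => w j * (if j == i :> nat
      then (2 / eta * s - l i * s) ^+ 2 else (l i * s) ^+ 2))); last first.
    move=> j _; rewrite real_normK ?num_real// /c; case: eqP => // _.
    by rewrite sub0r sqrrN.
  rewrite avg.
  (* The variance is the second moment minus the squared mean; dropping the latter leaves the
     quantity controlled by [var]. *)
  have -> : p i * (2 / eta * s - l i * s) ^+ 2 + (1 - p i) * (l i * s) ^+ 2 =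
      eta^-1 * (2 * l i * s ^+ 2) - (l i * s) ^+ 2 by rewrite /p; field.
  apply: (@le_trans _ _ (eta^-1 * (2 * l i * s ^+ 2))); first by rewrite gerBl sqr_ge0.
  by rewrite ler_pdivrMl// sE.
- by move=> i; exact: mulr_ge0.
- by move=> t i s _ /= <-; rewrite normrM ger0_norm.
Qed.

End instances.

Lemma hard_instance_le {R : realType} {d : nat} (L sigma : 'I_d -> R)
    (Delta eta : R) (T : nat) (m m' : R) : m' <= m ->
  hard_instance L sigma Delta eta T m -> hard_instance L sigma Delta eta T m'.
Proof.
move=> mm [f [x1 [K [smooth gap ex all]]]]; exists f, x1, K; split => //.
move=> disp Omega P x g /all[ub var ge]; split => //.
by apply: le_trans ge; rewrite lee_fin.
Qed.

(** Two parameters adapt the flips to any step size: [rho] shrinks the curvatures until the flip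
    probabilities sum to at most 1, and [s] replaces [eta] in the amplitudes so that the initial gap
    stays below [Delta]. Small steps use 1 and [eta], large ones the inverse of [d] and a fixed
    threshold. *)
Lemma scaled_flip_instance {R : realType} {d : nat} (L sigma : 'I_d -> R)
    (Delta eta : R) (T : nat) (rho s : R) :
  (forall i, 0 < L i) -> (forall i, 0 <= sigma i) -> 0 < eta -> (1 <= T)%N ->
  0 <= rho <= 1 -> 0 <= s <= eta ->
  s * (\sum_(i < d) sigma i ^+ 2) <= 4 * Delta ->
  rho * eta * (\sum_(i < d) L i) <= 2 ->
  hard_instance L sigma Delta eta T
    (rho * (\sum_(i < d) sigma i * Num.sqrt (L i)) * Num.sqrt (s / 2)).
Proof.
move=> L0 sigma0 eta0 T0 /andP[rho0 rho1] /andP[s0 seta] gap prob.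
pose a i := sigma i * Num.sqrt (s / (2 * L i)).
have a2 i : a i ^+ 2 = sigma i ^+ 2 * (s / (2 * L i)).
  by rewrite exprMn sqr_sqrtr// divr_ge0// mulr_ge0// ltW.
have -> : rho * (\sum_(i < d) sigma i * Num.sqrt (L i)) * Num.sqrt (s / 2) =
    \sum_(i < d) rho * L i * a i.
  rewrite mulr_sumr mulr_suml; apply: eq_bigr => i _.
  have Li := L0 i.
  have -> : s / 2 = L i * (s / (2 * L i)) by field; rewrite gt_eqF.
  rewrite sqrtrM ?ltW// [RHS](_ : _ = rho * Num.sqrt (L i) ^+ 2 * a i).
    by rewrite /a; ring.
  by rewrite sqr_sqrtr ?ltW.
apply: flip_instance => //.
- by move=> i; have Li := L0 i; apply/andP; split; nra.
- by move=> i; rewrite mulr_ge0// sqrtr_ge0.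
- rewrite (eq_bigr (fun i => rho * eta / 2 * L i)); last by move=> i _; field.
  by rewrite -mulr_sumr; nra.
- rewrite (eq_bigr (fun i => rho * s / 4 * sigma i ^+ 2)); last first.
    by move=> i _; rewrite a2; field; rewrite gt_eqF.
  rewrite -mulr_sumr.
  have : 0 <= \sum_(i < d) sigma i ^+ 2 by apply: sumr_ge0 => i _; exact: sqr_ge0.
  move: gap; set X := \sum_(i < d) _ => gap X0.
  have : 0 <= (1 - rho) * (s * X) by rewrite !mulr_ge0// subr_ge0.
  nra.
- move=> i; rewrite a2.
  have -> : 2 * (rho * L i) * (sigma i ^+ 2 * (s / (2 * L i))) =
      rho * s * sigma i ^+ 2 by field; rewrite gt_eqF.
  by apply: ler_wpM2r; rewrite ?sqr_ge0//; nra.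
Qed.

(** * Choice of the instance *)

(** Passing to fourth powers clears all the roots of the noise term before it is compared with other
    bounds. *)
Lemma noise_rate_pow4 {R : realType} (D Delta S N : R) :
  0 <= D -> 0 <= Delta -> 0 <= S -> 0 < N ->
  (D `^ (1 / 4) * Delta `^ (1 / 4) * Num.sqrt S / N `^ (1 / 4)) ^+ 4 =
  D * Delta * S ^+ 2 / N.
Proof.
move=> D0 Delta0 S0 N0.
have pow4 z : 0 <= z -> (z `^ (1 / 4)) ^+ 4 = z.
  move=> z0; rewrite -powR_mulrn ?powR_ge0// -powRrM.
  by rewrite (_ : 1 / 4 * 4%:R = 1) ?powRr1//; field.
have sqrt4 : Num.sqrt S ^+ 4 = S ^+ 2 by rewrite (exprM _ 2 2) sqr_sqrtr.
by rewrite !exprMn exprVn sqrt4 !pow4// ltW.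
Qed.

Lemma ler_of_sqr {R : realType} (x y : R) : 0 <= y -> x ^+ 2 <= y ^+ 2 -> x <= y.
Proof. by move=> y0 xy; rewrite leNgt; apply/negP => yx; nra. Qed.

Lemma quarter_sum_le {R : realFieldType} (x y z : R) :
  0 <= y -> x <= 2 * z -> y <= 2 * z -> 1 / 4 * (x + y) <= z.
Proof. by lra. Qed.

Theorem theorem4p1 (R : realType) :
  exists2 c : R, 0 < c &
  forall (d : nat) (L sigma : 'I_d -> R) (Delta : R),
    (1 <= d)%N -> (forall i, 0 < L i) -> (forall i, 0 <= sigma i) ->
    0 < Delta ->
  exists T0 : nat, forall (eta : R) (T : nat), 0 < eta -> (T0 <= T)%N ->
  exists (f : 'rV[R]_d -> R) (x1 : 'rV[R]_d) (K : oracle R d),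
  [/\ coordinate_smooth L f,
      initial_gap_le f x1 Delta,
      (exists (disp : measure_display) (Omega : measurableType disp)
              (P : probability Omega R) (x g : nat -> Omega -> 'rV[R]_d),
         sgd_run eta x1 K P x g) &
      forall (disp : measure_display) (Omega : measurableType disp)
             (P : probability Omega R) (x g : nat -> Omega -> 'rV[R]_d),
        sgd_run eta x1 K P x g ->
        [/\ unbiased f P x g,
            coordinate_variance_le sigma f P x g &
            ((c * (Num.sqrt (d%:R * \big[Num.max/0]_(i < d) L i * Delta / T%:R)
                   + d%:R `^ (1 / 4) * Delta `^ (1 / 4)
                     * Num.sqrt (\sum_(i < d) sigma i * Num.sqrt (L i))
                     / T%:R `^ (1 / 4)))%:E
             <= 'E_P[fun w => min_upto T (fun t => grad_l1norm f (x t w))])%E]].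
Proof.
(* With this constant it is enough that each of the two terms of the rate is at most twice the bound
   of the instance. *)
exists (1 / 4); first by rewrite divr_gt0.
move=> d L sigma Delta d1 L0 sigma0 Delta0.
have d0 : (0 : R) < d%:R by rewrite ltr0n.
set M := \big[Num.max/0]_(i < d) L i.
set S := \sum_(i < d) sigma i * Num.sqrt (L i).
have LM i : L i <= M by exact: le_bigmax.
have [i0 ME] : exists i0, M = L i0.
  pose j0 : 'I_d := Ordinal d1.
  case: (@arg_maxP _ R _ j0 xpredT L isT) => i _ iL; exists i.
  apply/le_anti; rewrite LM andbT; apply/bigmax_leP; split; first exact: ltW.
  by move=> j _; exact: iL.
have M0 : 0 < M by rewrite ME.
have S0 : 0 <= S by apply: sumr_ge0 => i _; rewrite mulr_ge0// sqrtr_ge0.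
pose SL := \sum_(i < d) L i.
pose S2 := \sum_(i < d) sigma i ^+ 2.
pose H := \sum_(i < d) (2 * L i)^-1.
have S20 : 0 <= S2 by apply: sumr_ge0 => i _; exact: sqr_ge0.
have SL0 : 0 < SL.
  by rewrite /SL (bigD1 i0)//= ltr_wpDr// sumr_ge0// => i _; exact: ltW.
have SLM : SL <= d%:R * M.
  rewrite /SL -[d in d%:R]card_ord -sum1_card natr_sum mulr_suml.
  by apply: ler_sum => i _; rewrite mul1r.
have H0 : 0 < H.
  rewrite /H (bigD1 i0)//= ltr_wpDr ?invr_gt0 ?mulr_gt0//.
  by apply: sumr_ge0 => i _; rewrite invr_ge0 mulr_ge0// ltW.
(* Below [eta0] the unscaled flips are admissible: the first entry controls the flip probabilities,
   the second the initial gap. Adding 1 avoids a zero denominator without noise. *)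
pose eta0 := Num.min (2 / SL) (4 * Delta / (S2 + 1)).
have eta00 : 0 < eta0 by rewrite lt_min !divr_gt0 ?mulr_gt0// ltr_wpDl.
have eta0SL : eta0 * SL <= 2 by rewrite -ler_pdivlMr// ge_min lexx.
have eta0S2 : eta0 * S2 <= 4 * Delta.
  apply: (@le_trans _ _ (eta0 * (S2 + 1))).
    by apply: ler_wpM2l; [exact: ltW|rewrite lerDl].
  by rewrite -ler_pdivlMr ?ltr_wpDl// ge_min lexx orbT.
(* Bounds independent of [T], in order: divergence, the plateau when [d * eta * T] is at most [H],
   and the scaled flips when [eta] exceeds [eta0]. *)
pose k1 := Num.sqrt (2 * M * Delta).
pose k2 := d%:R * Num.sqrt (Delta / (2 * H)).
pose k3 := d%:R^-1 * S * Num.sqrt (eta0 / 2).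
have k10 : 0 < k1 by rewrite sqrtr_gt0 !mulr_gt0.
have k20 : 0 < k2 by rewrite mulr_gt0// sqrtr_gt0 divr_gt0// mulr_gt0.
(* The bound [k3] is zero when [S] is, so it enters the minimum only for positive [S]. *)
have [k [k0 kk1 kk2 kk3]] : exists k, [/\ 0 < k, k <= k1, k <= k2 & 0 < S -> k <= k3].
  have [S_eq0|S_neq0] := eqVneq S 0.
    exists (Num.min k1 k2); rewrite lt_min k10 k20 !ge_min !lexx orbT; split => //.
    by rewrite S_eq0 ltxx.
  have Sp : 0 < S by rewrite lt_neqAle eq_sym S_neq0.
  have k30 : 0 < k3 by rewrite !mulr_gt0 ?invr_gt0// sqrtr_gt0 divr_gt0.
  exists (Num.min k1 (Num.min k2 k3)).
  by rewrite !lt_min k10 k20 k30 !ge_min !lexx !orbT.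
(* For [T] above [X], the first two summands put both terms of the rate below [k]; the third makes
   [H * M] at most [2 * d * T], as the plateau estimate requires. *)
pose X := d%:R * M * Delta / k ^+ 2 + d%:R * Delta * S ^+ 2 / k ^+ 4 + H * M / (2 * d%:R).
exists (Num.bound X).+1 => eta T eta_gt0 T0T.
have X0 : 0 <= X.
  by rewrite /X !addr_ge0// !(mulr_ge0, divr_ge0, invr_ge0, exprn_ge0)// ?ltW.
have TX : X <= T%:R.
  apply: ltW; apply: (lt_le_trans (archi_boundP X0)).
  by rewrite ler_nat ltnW.
have T1 : (1 <= T)%N by exact: leq_ltn_trans T0T.
have N0 : (0 : R) < T%:R by rewrite ltr0n.
have [X1 X2 X3] : [/\ d%:R * M * Delta / k ^+ 2 <= T%:R,
    d%:R * Delta * S ^+ 2 / k ^+ 4 <= T%:R & H * M / (2 * d%:R) <= T%:R].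
  have p1 : 0 <= d%:R * M * Delta / k ^+ 2.
    by rewrite !(mulr_ge0, invr_ge0, exprn_ge0)// ?ltW//.
  have p2 : 0 <= d%:R * Delta * S ^+ 2 / k ^+ 4.
    by rewrite !(mulr_ge0, invr_ge0, exprn_ge0)// ?ltW//.
  have p3 : 0 <= H * M / (2 * d%:R).
    by rewrite !(mulr_ge0, invr_ge0)// ?ltW//.
  by move: TX; rewrite /X; split; lra.
set A := Num.sqrt (d%:R * M * Delta / T%:R).
set B := d%:R `^ (1 / 4) * Delta `^ (1 / 4) * Num.sqrt S / T%:R `^ (1 / 4).
have A0 : 0 <= A by exact: sqrtr_ge0.
have B0 : 0 <= B by rewrite !(mulr_ge0, invr_ge0, powR_ge0, sqrtr_ge0).
have A2 : A ^+ 2 = d%:R * M * Delta / T%:R.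
  by rewrite sqr_sqrtr// !(mulr_ge0, invr_ge0)// ?ltW//.
have B4 : B ^+ 4 = d%:R * Delta * S ^+ 2 / T%:R by rewrite noise_rate_pow4// ltW.
have Ak : A <= k.
  apply: ler_of_sqr; first exact: ltW.
  by rewrite A2 ler_pdivrMr// [leRHS]mulrC -ler_pdivrMr ?exprn_gt0.
have Bk : B <= k.
  apply: ler_of_sqr; first exact: ltW.
  apply: ler_of_sqr; first exact: sqr_ge0.
  by rewrite -!exprM B4 ler_pdivrMr// [leRHS]mulrC -ler_pdivrMr ?exprn_gt0.
suff : hard_instance L sigma Delta eta T (1 / 4 * (A + B)) by exact.
have [eM|eM] := leP 2 (eta * M).
  apply: (@hard_instance_le _ _ _ _ _ _ _ k1).
    by apply: quarter_sum_le => //; lra.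
  by rewrite /k1 ME; apply: divergent_instance; rewrite -?ME// ltW.
(* The slope for which the plateau uses up the whole gap [Delta]. *)
pose g := Num.sqrt (Delta / (d%:R * eta * T%:R + H)).
have den0 : 0 < d%:R * eta * T%:R + H by rewrite addr_gt0// !mulr_gt0.
have g0 : 0 <= g by exact: sqrtr_ge0.
have g2 : g ^+ 2 = Delta / (d%:R * eta * T%:R + H).
  by rewrite sqr_sqrtr// divr_ge0// ltW.
have plateau : hard_instance L sigma Delta eta T (d%:R * g).
  apply: plateau_instance => //.
  have -> : \sum_(i < d) (eta * g ^+ 2 * T%:R + g ^+ 2 / (2 * L i)) =
      g ^+ 2 * (d%:R * eta * T%:R + H).
    rewrite big_split /= sumr_const card_ord -mulr_sumr -mulr_natl /H; ring.
  by rewrite g2 divfK// gt_eqF.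
(* After squaring, the claim is [M * (d * eta * T + H) <= 4 * d * T]; each of the two summands is at
   most [2 * d * T], by [eta * M < 2] and by the choice of [X]. *)
have A_plateau : A <= 2 * (d%:R * g).
  apply: ler_of_sqr; first by rewrite !mulr_ge0// ltW.
  rewrite A2 !exprMn g2 ler_pdivrMr//.
  rewrite (_ : 2 ^+ 2 * (d%:R ^+ 2 * (Delta / _)) * T%:R =
    d%:R * Delta * (4 * d%:R * T%:R) / (d%:R * eta * T%:R + H)); last first.
    by field; rewrite gt_eqF.
  rewrite ler_pdivlMr//.
  rewrite (_ : d%:R * M * Delta * _ = d%:R * Delta * (M * (d%:R * eta * T%:R + H)));
    last by ring.
  apply: ler_wpM2l; first by rewrite mulr_ge0// ltW.
  have HM : H * M <= T%:R * (2 * d%:R) by rewrite -ler_pdivrMr// mulr_gt0.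
  have dT : 0 < d%:R * T%:R :> R by rewrite mulr_gt0.
  have : d%:R * T%:R * (eta * M) <= d%:R * T%:R * 2 by rewrite ler_pM2l// ltW.
  lra.
have [BA|AB] := leP B A.
  by apply: hard_instance_le plateau; lra.
have Sp : 0 < S.
  rewrite lt_neqAle S0 andbT eq_sym; apply/eqP => S_eq0.
  by move: AB; rewrite ltNge {1}/B S_eq0 sqrtr0 mulr0 mul0r A0.
(* When [H] dominates the denominator of [g ^+ 2], the plateau already yields at least [k2], which
   does not depend on [T]. *)
have [etaH|etaH] := leP (d%:R * eta * T%:R) H.
  apply: hard_instance_le plateau; apply: (@le_trans _ _ k2); first lra.
  apply: ler_wpM2l; first exact: ltW.
  rewrite ler_sqrt; last by rewrite divr_ge0// ltW.
  apply: ler_wpM2l; first exact: ltW.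
  by rewrite lef_pV2 ?posrE// ?mulr_gt0//; lra.
(* For large steps the amplitudes are frozen at [eta0], and curvatures divided by [d] keep the flip
   probabilities admissible, since [SL <= d * M] and [eta * M < 2]. *)
have [eta_small|eta_large] := leP eta eta0; last first.
  apply: (@hard_instance_le _ _ _ _ _ _ _ k3); first by have := kk3 Sp; lra.
  apply: scaled_flip_instance => //.
  - by rewrite invr_ge0 ltW//= invf_le1// ler1n.
  - by rewrite !ltW.
  - rewrite -mulrA mulrC ler_pdivrMr//.
    apply: (@le_trans _ _ (eta * (d%:R * M))); first by rewrite ler_pM2l.
    have : d%:R * (eta * M) <= d%:R * 2 by rewrite ler_pM2l// ltW.
    lra.
pose mB := 1 * S * Num.sqrt (eta / 2).
have flip : hard_instance L sigma Delta eta T mB.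
  apply: scaled_flip_instance => //.
  - by rewrite ler01 lexx.
  - by rewrite ltW//= lexx.
  - by apply: le_trans eta0S2; apply: ler_wpM2r.
  - rewrite mul1r; apply: le_trans eta0SL.
    by apply: ler_wpM2r => //; exact: ltW.
have [mBB|mBB] := leP (B / 2) mB.
  by apply: hard_instance_le flip; lra.
apply: hard_instance_le plateau; apply: (@le_trans _ _ B); first lra.
apply: ler_of_sqr; first by rewrite mulr_ge0// ltW.
have mB0 : 0 <= mB by rewrite !mulr_ge0// sqrtr_ge0.
have mB2 : mB ^+ 2 = S ^+ 2 * eta / 2.
  rewrite /mB mul1r exprMn sqr_sqrtr; last by rewrite divr_ge0// ltW.
  by rewrite mulrA.
(* Since [H < d * eta * T], the denominator of [g ^+ 2] is at most [2 * (d * eta * T)]. *)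
have gd : (d%:R * g) ^+ 2 * (2 * (d%:R * eta * T%:R)) >= d%:R ^+ 2 * Delta.
  rewrite exprMn g2 -[leRHS]mulrA ler_pM2l ?exprn_gt0//.
  by rewrite mulrAC ler_pdivlMr// ler_pM2l//; lra.
(* The factor [eta] cancels between the plateau and flip bounds. As the flip bound is below [B / 2]
   here, dividing by [B ^+ 2] forces the plateau bound to be at least [B]. *)
have product : B ^+ 4 <= 4 * ((d%:R * g) ^+ 2 * mB ^+ 2).
  rewrite mB2 B4 ler_pdivrMr//.
  rewrite -(ler_pM2l d0).
  have -> : d%:R * (4 * ((d%:R * g) ^+ 2 * (S ^+ 2 * eta / 2)) * T%:R) =
      S ^+ 2 * ((d%:R * g) ^+ 2 * (2 * (d%:R * eta * T%:R))) by field.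
  have -> : d%:R * (d%:R * Delta * S ^+ 2) = S ^+ 2 * (d%:R ^+ 2 * Delta) by ring.
  by apply: ler_wpM2l => //; exact: sqr_ge0.
have Bp : 0 < B by exact: le_lt_trans AB.
have mBB2 : 4 * mB ^+ 2 <= B ^+ 2.
  have mBB' : 2 * mB <= B by rewrite mulrC -ler_pdivlMr// ltW.
  have -> : 4 * mB ^+ 2 = (2 * mB) ^+ 2 by ring.
  by apply: lerXn2r; rewrite // nnegrE mulr_ge0.
rewrite -(@ler_pM2r _ (B ^+ 2)); last exact: exprn_gt0.
rewrite -exprD; apply: le_trans product _.
rewrite mulrCA; apply: ler_wpM2l => //; exact: sqr_ge0.
Qed.
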